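(* Let $n\ge 2$ and $k\ge 1$ be integers. Among the $U(n)$-invariant Kähler metrics on the Hirzebruch manifold $M_{n,k}$, Hitchin's examples are exactly (up to scaling of the metric) those for which the curvature component $A$, i.e. the holomorphic sectional curvature along the fiber direction, is constant on $M_{n,k}$.
   Context: $M_{n,k}=\mathbb{P}(H^{k}\oplus 1_{\mathbb{CP}^{n-1}})\to\mathbb{CP}^{n-1}$, with $H$ the hyperplane bundle. It is viewed as the compactification of $L^{*}=L\setminus\{\text{zero section}\}$, $L=H^{-k}$, obtained by adding the zero section $E_0$ and the infinity section $E_\infty$; $U(n)$ acts on it through its natural action on $\mathbb{C}^n$. Let $g_0$ be the Fubini-Study metric on $\mathbb{CP}^{n-1}$ with $Ric(g_0)=g_0$, $h$ the $U(n)$-invariant Hermitian metric on $L$, and $r=|v|_h$ the norm function on $L$. Generating functions: let $\phi$ be a smooth function on $[U_{min},U_{max}]$ with $1+\frac{k}{n}U_{min}>0$, $\phi>0$ on $(U_{min},U_{max})$, $\phi(U_{min})=\phi(U_{max})=0$, $\phi'(U_{min})=2$, $\phi'(U_{max})=-2$. Regard $U$ as a function of $r$ by solving $r\,\frac{dU}{dr}=\phi(U)$ (with $U\to U_{min}$ as $r\to 0$ and $U\to U_{max}$ as $r\to\infty$), and let $t$ be defined by $dt=dU/\sqrt{\phi(U)}$. The associated Kähler metric is $\tilde g=(1+\frac{k}{n}U)\,\pi^{*}g_0+dt^2+(dt\circ\tilde J)^2$ on $L^{*}$ ($\tilde J$ the complex structure), which extends smoothly to $M_{n,k}$. The $U(n)$-invariant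 Kähler metrics on $M_{n,k}$ are those of this form. Let $A=\tilde R_{0\bar 00\bar 0}$, where $e_0$ is a unit $(1,0)$ vector tangent to the fiber of $M_{n,k}\to\mathbb{CP}^{n-1}$. Hitchin's examples on $M_{n,k}$ are the metrics with generating function $\phi_s(U)=-\frac{2}{ns}U^2+2U$ on $[U_{min},U_{max}]=[0,ns]$, for $s>0$. *)

(* Defs.v *)
From HB Require Import structures.
From mathcomp Require Import all_boot all_order all_algebra.
From mathcomp Require Import sesquilinear spectral complex.
From mathcomp Require Import all_classical all_reals all_analysis.

Set Implicit Arguments.
Unset Strict Implicit.
Unset Printing Implicit Defensive.

Import Order.TTheory GRing.Theory Num.Theory.
Import numFieldNormedType.Exports.

Local Open Scope classical_set_scope.
Local Open Scope ring_scope.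
Local Open Scope complex_scope.
Local Open Scope sesquilinear_scope.

(* Derivatives along v of functions on C^m seen as a real vector space. *)
Definition rderive (R : realType) m (v : 'rV[R[i]]_m) (f : 'rV[R[i]]_m -> R)
    (p : 'rV[R[i]]_m) : R :=
  derive1 (fun t : R => f (p + t%:C *: v)) 0.

Definition rderivable (R : realType) m (v : 'rV[R[i]]_m)
    (f : 'rV[R[i]]_m -> R) (p : 'rV[R[i]]_m) : Prop :=
  derivable (fun t : R => f (p + t%:C *: v)) 0 1.

Definition cderive (R : realType) m (v : 'rV[R[i]]_m)
    (f : 'rV[R[i]]_m -> R[i]) (p : 'rV[R[i]]_m) : R[i] :=
  rderive v (fun q => complex.Re (f q)) p
    +i* rderive v (fun q => complex.Im (f q)) p.

Definition cderivable (R : realType) m (v : 'rV[R[i]]_m)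
    (f : 'rV[R[i]]_m -> R[i]) (p : 'rV[R[i]]_m) : Prop :=
  rderivable v (fun q => complex.Re (f q)) p /\
  rderivable v (fun q => complex.Im (f q)) p.

(* C^oo on the open set D, in the real sense: the iterated directional
   derivatives of all orders exist and are continuous on D.  The alias R[i]^o
   carries the topology of R[i]. *)
Definition smooth_on (R : realType) m (D : set 'rV[R[i]]_m)
    (f : 'rV[R[i]]_m -> R[i]) : Prop :=
  forall (vs : seq 'rV[R[i]]_m) (p : 'rV[R[i]]_m), D p ->
    let h := foldr (@cderive R m) f vs in
    continuous_at (p : 'rV[R[i]^o]_m) (h : 'rV[R[i]^o]_m -> R[i]^o) /\
    forall v, cderivable v h p.

(* The Wirtinger operators d/dz_a and d/dzbar_a. *)
Definition dz (R : realType) m (a : 'I_m) (f : 'rV[R[i]]_m -> R[i])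
    (p : 'rV[R[i]]_m) : R[i] :=
  (cderive (delta_mx 0 a) f p - 'i%C * cderive ('i%C *: delta_mx 0 a) f p) / 2.

Definition dzbar (R : realType) m (a : 'I_m) (f : 'rV[R[i]]_m -> R[i])
    (p : 'rV[R[i]]_m) : R[i] :=
  (cderive (delta_mx 0 a) f p + 'i%C * cderive ('i%C *: delta_mx 0 a) f p) / 2.

(* A Riemannian metric g compatible with the complex structure is encoded by
   the matrix G a b = g(d/dz_a, d/dzbar_b), g being extended complex
   bilinearly.  For (1,0) vectors X, Y one has g(X, Ybar) = sform (G p) X Y,
   and the squared length of the real vector X + Xbar is 2 * sform (G p) X X. *)
Definition sform (R : realType) m (H : 'M[R[i]]_m) (X Y : 'rV[R[i]]_m) : R[i] :=
  (X *m H *m Y^t*) 0 0.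

(* R_{a bbar c dbar}
     = - d_c d_dbar g_{a bbar} + g^{tbar s} d_c g_{a tbar} d_dbar g_{s bbar} *)
Definition riem (R : realType) m (H : 'rV[R[i]]_m -> 'M[R[i]]_m)
    (p : 'rV[R[i]]_m) (a b c d : 'I_m) : R[i] :=
  - dz c (dzbar d (fun q => H q a b)) p
  + \sum_s \sum_t dz c (fun q => H q a t) p * invmx (H p) t s
                  * dzbar d (fun q => H q s b) p.

(* R(X, Xbar, X, Xbar); when X is a unit (1,0) vector this is the holomorphic
   sectional curvature in the direction X. *)
Definition riem_at (R : realType) m (H : 'rV[R[i]]_m -> 'M[R[i]]_m)
    (p X : 'rV[R[i]]_m) : R[i] :=
  \sum_a \sum_b \sum_c \sum_d
    riem H p a b c d * X 0 a * (X 0 b)^*%R * X 0 c * (X 0 d)^*%R.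

(* M_{n,k} = P(H^k (+) 1) is the quotient of
     homog n = (C^n \ 0) x (C^2 \ 0)
   by the free action of (C^* )^2 given by
     (lam, mu) . (x; y0, y1) = (lam x; mu lam^-k y0, mu y1).
   For y1 <> 0, the class [x; y0 : y1] is the point (y0 / y1) x^{(x) k} of
   L = H^-k; E_0 is {y0 = 0} and E_oo is {y1 = 0}. *)
Definition hx (R : realType) n (p : 'rV[R[i]]_(n + 2)) : 'rV[R[i]]_n :=
  lsubmx p.
Definition hy0 (R : realType) n (p : 'rV[R[i]]_(n + 2)) : R[i] :=
  rsubmx p 0 0.
Definition hy1 (R : realType) n (p : 'rV[R[i]]_(n + 2)) : R[i] :=
  rsubmx p 0 1.

Definition homog (R : realType) n : set 'rV[R[i]]_(n + 2) :=
  [set p | hx p != 0 /\ rsubmx p != 0].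

Definition homog_star (R : realType) n : set 'rV[R[i]]_(n + 2) :=
  [set p | [/\ hx p != 0, hy0 p != 0 & hy1 p != 0]].

Definition torus_mx (R : realType) n (k : nat) (lam mu : R[i]) :
    'M[R[i]]_(n + 2) :=
  diag_mx (row_mx (const_mx lam)
                  (\row_(j < 2) if j == 0 then mu * lam ^- k else mu)).

(* (x; y) |-> (x u; y), which descends to the action of u on M_{n,k}. *)
Definition unitary_mx (R : realType) n (u : 'M[R[i]]_n) : 'M[R[i]]_(n + 2) :=
  block_mx u 0 0 1%:M.

Definition invariant_under (R : realType) n (T : 'M[R[i]]_(n + 2))
    (G : 'rV[R[i]]_(n + 2) -> 'M[R[i]]_(n + 2)) : Prop :=
  forall p, homog p -> T *m G (p *m T) *m T^t* = G p.

(* Tangent vectors at p to the orbit of the (C^* )^2-action. *)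
Definition orbit_tangent (R : realType) n (k : nat)
    (p X : 'rV[R[i]]_(n + 2)) : Prop :=
  exists a b : R[i],
    X = row_mx (a *: hx p)
          (\row_(j < 2) if j == 0 then (b - k%:R * a) * hy0 p else b * hy1 p).

(* A Kaehler metric on M_{n,k}, encoded by its pullback G to homog n.  The
   pullbacks of Hermitian metrics of the quotient are exactly the smooth
   semipositive Hermitian forms invariant under (C^* )^2 whose null spaces are
   the tangent spaces to the orbits; such a metric is Kaehler iff its
   pullback is closed.  Values of G outside homog n are irrelevant. *)
Record kahler_metric (R : realType) n (k : nat)
    (G : 'rV[R[i]]_(n + 2) -> 'M[R[i]]_(n + 2)) : Prop := KahlerMetric {
  kahler_smooth : forall a b, smooth_on (@homog R n) (fun p => G p a b);
  kahler_herm : forall p, homog p -> (G p)^t* = G p;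
  kahler_ge0 : forall p X, homog p -> 0 <= sform (G p) X X;
  kahler_null : forall p X, homog p ->
    (sform (G p) X X = 0 <-> orbit_tangent k p X);
  kahler_torus : forall lam mu : R[i], lam != 0 -> mu != 0 ->
    invariant_under (torus_mx n k lam mu) G;
  kahler_closed : forall p (a b c : 'I_(n + 2)), homog p ->
    dz c (fun q => G q a b) p = dz a (fun q => G q c b) p
}.

Definition unitary_kahler_metric (R : realType) n (k : nat)
    (G : 'rV[R[i]]_(n + 2) -> 'M[R[i]]_(n + 2)) : Prop :=
  kahler_metric k G /\
  forall u : 'M[R[i]]_n, u \is unitarymx -> invariant_under (unitary_mx u) G.

(* The holomorphic chart C^n -> M_{n,k} with index (i, j): p is sent to the
   class of (x; y) with x_i = 1, x_l = p_l for l <> i, y_j = p_i and the other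
   y-coordinate equal to 1.  These 2n charts cover M_{n,k}; the i-th
   coordinate is the coordinate along the fiber over CP^{n-1}. *)
Definition chart_lin (R : realType) n (i : 'I_n) (j : 'I_2) :
    'M[R[i]]_(n, n + 2) :=
  row_mx (\matrix_(a < n, l < n) ((a == l) && (l != i))%:R)
         (\matrix_(a < n, l < 2) ((a == i) && (l == j))%:R).

Definition chart (R : realType) n (i : 'I_n) (j : 'I_2) (p : 'rV[R[i]]_n) :
    'rV[R[i]]_(n + 2) :=
  p *m chart_lin R i j + row_mx (delta_mx 0 i) (delta_mx 0 (rev_ord j)).

Definition chart_metric (R : realType) n
    (G : 'rV[R[i]]_(n + 2) -> 'M[R[i]]_(n + 2)) (i : 'I_n) (j : 'I_2)
    (p : 'rV[R[i]]_n) : 'M[R[i]]_n :=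
  chart_lin R i j *m G (chart i j p) *m (chart_lin R i j)^t*.

(* A = R(e_0, e_0bar, e_0, e_0bar), e_0 a unit (1,0) vector tangent to the
   fiber, is constant on the whole of M_{n,k}, E_0 and E_oo included. *)
Definition constant_A (R : realType) n
    (G : 'rV[R[i]]_(n + 2) -> 'M[R[i]]_(n + 2)) : Prop :=
  exists A : R, forall (i : 'I_n) (j : 'I_2) (p e0 : 'rV[R[i]]_n),
    (exists z : R[i], e0 = z *: delta_mx 0 i) ->
    sform (chart_metric G i j p) e0 e0 = 1 ->
    riem_at (chart_metric G i j) p e0 = A%:C.

Definition enorm (R : realType) n (x : 'rV[R[i]]_n) : R :=
  Num.sqrt (\sum_a ComplexField.Normc.normc (x 0 a) ^+ 2).

(* The norm function r = |v|_h on L^*, where h is induced by the standard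
   Hermitian metric on C^n. *)
Definition rad (R : realType) n (k : nat) (p : 'rV[R[i]]_(n + 2)) : R :=
  ComplexField.Normc.normc (hy0 p / hy1 p) * enorm (hx p) ^+ k.

(* The value on the real vector xi of (the pullback to C^n \ 0 of) the
   Fubini-Study metric g_0 on CP^{n-1}.  The normalization Ric(g_0) = g_0
   amounts to the Kaehler form i n d dbar log |x|^2, because the Ricci form of
   a Fubini-Study metric on CP^{n-1} is i n d dbar log |x|^2 irrespective of
   its scale; the factor 2 is the one relating g(X, X) to sform above. *)
Definition fubini_study (R : realType) n (x xi : 'rV[R[i]]_n) : R :=
  2 * n%:R * (enorm xi ^+ 2 / enorm x ^+ 2
              - ComplexField.Normc.normc ((xi *m x^t*) 0 0) ^+ 2 / enorm x ^+ 4).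

(* dt on the real vector X, for dt = dU / sqrt (phi U) and U = U(r). *)
Definition dt_form (R : realType) n (k : nat) (phi U : R -> R)
    (p X : 'rV[R[i]]_(n + 2)) : R :=
  rderive X (fun q => U (rad k q)) p / Num.sqrt (phi (U (rad k p))).

(* On L^*, the metric G is (1 + (k/n) U) pi^* g_0 + dt^2 + (dt o J)^2 for some
   solution U of r dU/dr = phi(U) going from Umin to Umax. *)
Definition has_generating_function (R : realType) n (k : nat)
    (phi : R -> R) (Umin Umax : R)
    (G : 'rV[R[i]]_(n + 2) -> 'M[R[i]]_(n + 2)) : Prop :=
  exists U : R -> R,
    [/\ forall r : R, 0 < r ->
          [/\ Umin < U r < Umax, derivable U r 1 & r * derive1 U r = phi (U r)],
        U r @[r --> 0^'+] --> Umin,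
        U r @[r --> +oo] --> Umax
      & forall p X, homog_star p ->
          2 * sform (G p) X X =
          ((1 + k%:R / n%:R * U (rad k p)) * fubini_study (hx p) (hx X)
           + dt_form k phi U p X ^+ 2
           + dt_form k phi U p ('i%C *: X) ^+ 2)%:C].

Definition hitchin_phi (R : realType) (n : nat) (s : R) : R -> R :=
  fun U => - (2 / (n%:R * s)) * U ^+ 2 + 2 * U.

Definition hitchin_metric (R : realType) n (k : nat) (s : R)
    (G : 'rV[R[i]]_(n + 2) -> 'M[R[i]]_(n + 2)) : Prop :=
  unitary_kahler_metric k G /\
  has_generating_function k (hitchin_phi n s) 0 (n%:R * s) G.

(* Main.v *)
(**
A U(n)-invariant Kaehler metric is determined by its values at the points
(e_0; r, 1): these meet every orbit of U(n) x (C^* )^2 on L^*, and at such a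
point the reflections fixing e_0 diagonalize the metric.  Hence on L^* it is
  a(r) FS + r^2 h(r) eta (x) conj(eta),   eta = d log v^2,
and closedness amounts to a' = 2 k r h.

In a chart, along a fiber, the row of the metric matrix indexed by the fiber
coordinate z is Phi(|z|^2) (1, kappa zbar) with kappa constant.  So d/dz of this
row is a multiple of the row itself, the inverse matrix disappears from
R_{z zbar z zbar}, and A = -(d dbar log Phi) / Phi.

If A is constant, this Liouville equation has the first integral
r h'/(2h) + (A/k) a; integrating again with a' = 2 k r h gives
k r^2 h = V - (A/2k) V^2 for V = a - a(0), i.e. the logistic equation satisfied
by Hitchin's examples.  The behaviour at E_oo forces A > 0.  Conversely, the
logistic equation gives Phi = C / (1 + K |z|^2)^2, a Fubini-Study metric on each
fiber, and A = 2K/C does not depend on the fiber.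
*)
Require Import Defs.
From mathcomp Require Import all_boot all_order all_algebra.
From mathcomp Require Import sesquilinear spectral complex.
From mathcomp Require Import all_classical all_reals all_analysis.
From mathcomp Require Import ring lra.
Import Defs.
Set Implicit Arguments.
Unset Strict Implicit.
Unset Printing Implicit Defensive.
Import Order.TTheory GRing.Theory Num.Theory.
Import numFieldNormedType.Exports.
Local Open Scope classical_set_scope.
Local Open Scope ring_scope.
Local Open Scope complex_scope.
Local Open Scope sesquilinear_scope.

(** The formula for the metric on L^* contains eta, which is singular on E_0 and E_oo, whereas A is
    considered on all of M_{n,k} and both integrations start on E_0. The bridge is the smoothness of
    the entries of G across the two sections. The functions a and h are taken along the whole real
    line (e_0; r, 1), so they are differentiable at r = 0, where the first integrals vanish; for
    Hitchin's examples, the row formula known for z != 0 extends to z = 0 by continuity along a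
    line. The number kappa is constant because FS vanishes against vertical vectors: only the eta
    term enters the row, with eta(d/dz) = 1/z or -1/z, and eta of a base vector does not depend on
    z. Near E_oo the good coordinate is 1/r: there r^2 h is r^-2 times a convergent entry, so it
    tends to 0, while V increases to a finite limit V_oo > 0. Hence V_oo is a root of V - (A/2k)
    V^2, and A V_oo = 2k. Closedness enters through d_{y_0} G(x_1, x_1) = d_{x_1} G(y_0, x_1), where
    x_1 is a direction tangent to the base; such a direction exists because n >= 2. *)

(** * One-variable real calculus *)

Section RealDerivatives.
Variable R : realType.
Implicit Types (x a b : R) (f g : R -> R).

(* Unlike [is_derive], not a class: applying the rules below does not trigger
   instance resolution. *)
Definition has_deriv f x a : Prop := is_derive x 1 f a.

Lemma has_deriv_eq x f a b : has_deriv f x a -> a = b -> has_deriv f x b.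
Proof. by move=> h <-. Qed.

Lemma has_deriv_derive1 x f a : has_deriv f x a -> derive1 f x = a.
Proof. by move=> h; rewrite derive1E; exact: derive_val. Qed.

Lemma derivable_has_deriv x f : derivable f x 1 -> has_deriv f x (derive1 f x).
Proof. by move=> h; rewrite derive1E; exact: derivableP. Qed.

Lemma has_deriv_ext x f g a : f =1 g -> has_deriv f x a -> has_deriv g x a.
Proof. by move=> /funext ->. Qed.

Lemma has_deriv_cst x a : has_deriv (fun=> a) x 0.
Proof. exact: is_derive_cst. Qed.

Lemma has_deriv_id x : has_deriv (fun t : R => t) x 1.
Proof. exact: is_derive_id. Qed.

Lemma has_derivD x f g a b : has_deriv f x a -> has_deriv g x b ->
  has_deriv (fun t => f t + g t) x (a + b).
Proof. by move=> hf hg; exact: is_deriveD. Qed.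

Lemma has_derivN x f a : has_deriv f x a -> has_deriv (fun t => - f t) x (- a).
Proof. by move=> hf; exact: is_deriveN. Qed.

Lemma has_derivB x f g a b : has_deriv f x a -> has_deriv g x b ->
  has_deriv (fun t => f t - g t) x (a - b).
Proof. by move=> hf hg; exact: is_deriveB. Qed.

Lemma has_derivM x f g a b : has_deriv f x a -> has_deriv g x b ->
  has_deriv (fun t => f t * g t) x (a * g x + f x * b).
Proof.
move=> hf hg; have h := is_deriveM hf hg; apply: (has_deriv_eq h).
by rewrite /GRing.scale /=; ring.
Qed.

Lemma has_derivX x f a n : has_deriv f x a ->
  has_deriv (fun t => f t ^+ n) x (n%:R * f x ^+ n.-1 * a).
Proof.
move=> hf; have := is_deriveX n hf.
suff -> : f ^+ n = (fun t => f t ^+ n) by [].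
by apply/funext => t; rewrite exprfctE.
Qed.

Lemma has_derivV x f a : f x != 0 -> has_deriv f x a ->
  has_deriv (fun t => (f t)^-1) x (- (f x) ^- 2 * a).
Proof.
move=> f0 [hf <-]; apply: DeriveDef; first exact: derivableV.
by rewrite deriveV.
Qed.

Lemma has_deriv_affine x a b : has_deriv (fun t : R => a + t * b) x b.
Proof.
apply: has_deriv_eq.
  exact: has_derivD (has_deriv_cst x a)
    (has_derivM (has_deriv_id x) (has_deriv_cst x b)).
by rewrite mulr0 addr0 add0r mul1r.
Qed.

Lemma has_deriv_comp x f g a b :
  has_deriv f x a -> has_deriv g (f x) b ->
  has_deriv (fun t => g (f t)) x (b * a).
Proof.
move=> [hf <-] [hg <-].
have hf' := (derivable1_diffP f x).1 hf.
have hg' := (derivable1_diffP g (f x)).1 hg.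
apply: DeriveDef.
  exact: (derivable1_diffP _ _).2 (differentiable_comp hf' hg').
exact: etrans (esym (derive1E (g \o f) x)) (etrans (derive1_comp hf hg)
  (congr2 *%R (derive1E g (f x)) (derive1E f x))).
Qed.

Lemma has_deriv_near x f g a : (\forall t \near x, f t = g t) ->
  has_deriv f x a -> has_deriv g x a.
Proof. exact: near_eq_is_derive. Qed.

Lemma has_deriv_shift x f a :
  has_deriv f x a <-> has_deriv (fun t => f (x + t)) 0 a.
Proof.
have shiftd (y c : R) : has_deriv (fun t => c + t) y 1.
  apply: has_deriv_eq; last exact: add0r.
  exact: has_derivD (has_deriv_cst y c) (has_deriv_id y).
split=> h.
  apply: has_deriv_eq; last exact: mulr1.
  by apply: has_deriv_comp (shiftd 0 x) _; rewrite addr0.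
have -> : f = (fun t => (fun s => f (x + s)) (- x + t)).
  by apply/funext => t; rewrite addNKr.
apply: has_deriv_eq; last exact: mulr1.
apply: (@has_deriv_comp _ _ (fun s => f (x + s)) _ _ (shiftd x (- x))).
by rewrite addNr.
Qed.

Lemma has_deriv_continuous x f a : has_deriv f x a -> f t @[t --> x] --> f x.
Proof. by case=> /derivable1_diffP/differentiable_continuous. Qed.

(** Mean value theorem on [0, x]. Only continuity is asked at 0, since the differential equations
    along a fiber are available for r > 0; the value at 0 then fixes the constant of integration. *)
Lemma derive0_eq0 f : f t @[t --> (0 : R)] --> f 0 ->
  (forall x, 0 < x -> has_deriv f x 0) -> forall x, 0 < x -> f x = f 0.
Proof.
move=> f0 fd x x0.
have [||c _] := @MVT R f (fun=> 0) 0 x x0.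
- by move=> c; rewrite in_itv /= => /andP[c0 _]; exact: fd.
- apply/continuous_within_itvP => //; split.
  + move=> c; rewrite in_itv /= => /andP[c0 _].
    exact: has_deriv_continuous (fd c c0).
  + exact: cvg_at_right_filter f0.
  + exact/cvg_at_left_filter/(has_deriv_continuous (fd x x0)).
by rewrite mul0r => /eqP; rewrite subr_eq0 => /eqP.
Qed.

End RealDerivatives.

(** * Wirtinger derivatives of functions on C^m *)

Section WirtingerCalculus.
Variables (R : realType).
Implicit Types (z w : R[i]).

Definition sqnorm (z : R[i]) : R := complex.Re z ^+ 2 + complex.Im z ^+ 2.

Lemma sqnormE z : (sqnorm z)%:C = z * (z^*)%R.
Proof.
case: z => x y; apply/eqP; rewrite eq_complex /sqnorm /=.
by apply/andP; split; apply/eqP; ring.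
Qed.

Lemma sqnorm_ge0 z : 0 <= sqnorm z.
Proof. by rewrite addr_ge0 ?sqr_ge0. Qed.

Lemma sqnorm_eq0 z : (sqnorm z == 0) = (z == 0).
Proof. by rewrite paddr_eq0 ?sqr_ge0 // !sqrf_eq0 eq_complex. Qed.

Lemma sqnorm_gt0 z : (0 < sqnorm z) = (z != 0).
Proof. by rewrite lt_def sqnorm_ge0 sqnorm_eq0 andbT. Qed.

Lemma sqnorm0 : sqnorm 0 = 0.
Proof. by apply/eqP; rewrite sqnorm_eq0. Qed.

Lemma sqnorm1 : sqnorm 1 = 1.
Proof. by rewrite /sqnorm /= expr1n expr0n addr0. Qed.

Lemma realC_neq0 (x : R) : (x%:C != 0 :> R[i]) = (x != 0).
Proof. by rewrite eq_complex /= eqxx andbT. Qed.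

Lemma sqnormM z w : sqnorm (z * w) = sqnorm z * sqnorm w.
Proof. by case: z w => a b [c d]; rewrite /sqnorm /=; ring. Qed.

Lemma sqnormX z m : sqnorm (z ^+ m) = sqnorm z ^+ m.
Proof. by elim: m => [|m IH]; rewrite ?sqnorm1 // !exprS sqnormM IH. Qed.

Lemma sqnormV z : sqnorm z^-1 = (sqnorm z)^-1.
Proof.
have [->|z0] := eqVneq z 0; first by rewrite invr0 sqnorm0 invr0.
have s0 : sqnorm z != 0 by rewrite sqnorm_eq0.
apply: (mulfI s0); by rewrite -sqnormM !divff // sqnorm1.
Qed.

Lemma sqnorm_real (x : R) : sqnorm x%:C = x ^+ 2.
Proof. by rewrite /sqnorm /= expr0n addr0. Qed.

Lemma normc_sqnorm z : ComplexField.Normc.normc z = Num.sqrt (sqnorm z).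
Proof. by case: z. Qed.

Lemma ReMr (x : R) z : complex.Re (x%:C * z) = x * complex.Re z.
Proof. by case: z => a b /=; rewrite mul0r subr0. Qed.

Lemma ImMr (x : R) z : complex.Im (x%:C * z) = x * complex.Im z.
Proof. by case: z => a b /=; rewrite mul0r addr0. Qed.

Lemma ReM z w : complex.Re (z * w) =
  complex.Re z * complex.Re w - complex.Im z * complex.Im w.
Proof. by case: z w => a b [c d]. Qed.

Lemma ImM z w : complex.Im (z * w) =
  complex.Re z * complex.Im w + complex.Im z * complex.Re w.
Proof. by case: z w => a b [c d]. Qed.

Lemma ReD z w : complex.Re (z + w) = complex.Re z + complex.Re w.
Proof. by case: z w => a b [c d]. Qed.

Lemma ImD z w : complex.Im (z + w) = complex.Im z + complex.Im w.
Proof. by case: z w => a b [c d]. Qed.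

Lemma Re_conj z : complex.Re (z^*)%R = complex.Re z.
Proof. by case: z. Qed.

Lemma Im_conj z : complex.Im (z^*)%R = - complex.Im z.
Proof. by case: z. Qed.

Variable m : nat.
Implicit Types (v p : 'rV[R[i]]_m) (f g : 'rV[R[i]]_m -> R[i]).

Definition is_cderive v f p (l : R[i]) : Prop :=
  has_deriv (fun t : R => complex.Re (f (p + t%:C *: v))) 0 (complex.Re l) /\
  has_deriv (fun t : R => complex.Im (f (p + t%:C *: v))) 0 (complex.Im l).

Lemma is_cderiveE v f p l : is_cderive v f p l -> cderive v f p = l.
Proof.
case=> hr hi; rewrite /cderive /rderive (has_deriv_derive1 hr).
by rewrite (has_deriv_derive1 hi); case: l {hr hi}.
Qed.

Lemma cderivable_is v f p : cderivable v f p -> is_cderive v f p (cderive v f p).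
Proof.
case=> hr hi; split; first exact: derivable_has_deriv hr.
exact: derivable_has_deriv hi.
Qed.

Lemma is_cderive_near v f g p l :
  (\forall t \near (0 : R), f (p + t%:C *: v) = g (p + t%:C *: v)) ->
  is_cderive v f p l -> is_cderive v g p l.
Proof.
move=> fg [hr hi]; split.
  by apply: has_deriv_near hr; apply: filterS fg => t ->.
by apply: has_deriv_near hi; apply: filterS fg => t ->.
Qed.

Lemma is_cderive_cst v p c : is_cderive v (fun=> c) p 0.
Proof. by split; exact: has_deriv_cst. Qed.

Lemma is_cderive_coord v p a : is_cderive v (fun q => q 0 a) p (v 0 a).
Proof.
split.
  under eq_fun do rewrite !mxE ReD ReMr.
  exact: has_deriv_affine.
under eq_fun do rewrite !mxE ImD ImMr.
exact: has_deriv_affine.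
Qed.

Lemma is_cderive_conj v f p l :
  is_cderive v f p l -> is_cderive v (fun q => (f q)^*%R) p (l^*)%R.
Proof.
case=> hr hi; split; rewrite ?Re_conj ?Im_conj.
  by under eq_fun do rewrite Re_conj.
under eq_fun do rewrite Im_conj.
exact: has_derivN.
Qed.

Lemma line0 p v : p + (0 : R)%:C *: v = p.
Proof. by rewrite scale0r addr0. Qed.

Lemma is_cderiveM v f g p l k :
  is_cderive v f p l -> is_cderive v g p k ->
  is_cderive v (fun q => f q * g q) p (l * g p + f p * k).
Proof.
case=> fr fi [gr gi]; split.
  under eq_fun do rewrite ReM.
  apply: has_deriv_eq.
    exact: has_derivB (has_derivM fr gr) (has_derivM fi gi).
  by cbv beta; rewrite !line0 ReD !ReM; ring.
under eq_fun do rewrite ImM.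
apply: has_deriv_eq.
  exact: has_derivD (has_derivM fr gi) (has_derivM fi gr).
by cbv beta; rewrite !line0 ImD !ImM; ring.
Qed.

Lemma is_cderive_sqnorm v p a :
  has_deriv (fun t : R => sqnorm ((p + t%:C *: v) 0 a)) 0
    (2 * complex.Re (v 0 a * (p 0 a)^*%R)).
Proof.
have [hr hi] := is_cderive_coord v p a.
apply: has_deriv_eq.
  exact: has_derivD (has_derivX 2 hr) (has_derivX 2 hi).
by cbv beta; rewrite !line0 ReM Re_conj Im_conj /=; ring.
Qed.

Lemma is_cderive_radial v p a (phi : R -> R) d :
  has_deriv phi (sqnorm (p 0 a)) d ->
  is_cderive v (fun q => (phi (sqnorm (q 0 a)))%:C) p
    (2 * complex.Re (v 0 a * (p 0 a)^*%R) * d)%:C.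
Proof.
move=> hphi; split; last exact: has_deriv_cst.
rewrite mulrC; apply: (has_deriv_comp (is_cderive_sqnorm v p a)).
by rewrite line0.
Qed.

(* The complex directional derivatives along e_a and i e_a, expressed through
   l = df/dz_a and l' = df/dzbar_a. *)
Definition is_wirtinger (a : 'I_m) f p (l l' : R[i]) : Prop :=
  is_cderive (delta_mx 0 a) f p (l + l') /\
  is_cderive ('i%C *: delta_mx 0 a) f p ('i%C * (l - l')).

Lemma ii : 'i%C * 'i%C = -1 :> R[i].
Proof. by rewrite -expr2 sqr_i. Qed.

Lemma wirtinger_dz a f p l l' : is_wirtinger a f p l l' -> dz a f p = l.
Proof.
case=> h1 h2; rewrite /dz (is_cderiveE h1) (is_cderiveE h2) mulrA ii.
by field.
Qed.

Lemma wirtinger_dzbar a f p l l' : is_wirtinger a f p l l' -> dzbar a f p = l'.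
Proof.
case=> h1 h2; rewrite /dzbar (is_cderiveE h1) (is_cderiveE h2) mulrA ii.
by field.
Qed.

(** The derivatives in z_a depend only on the restriction to the complex line through p in the
    direction e_a, so a formula known along one fiber is enough to differentiate. *)
Lemma wirtinger_near a f g p l l' :
  (forall c : R[i], \forall t \near (0 : R),
     f (p + (t%:C * c) *: delta_mx 0 a) = g (p + (t%:C * c) *: delta_mx 0 a)) ->
  is_wirtinger a f p l l' -> is_wirtinger a g p l l'.
Proof.
move=> fg [h1 h2]; split.
  apply: is_cderive_near h1; have := fg 1; apply: filterS => t.
  by rewrite mulr1.
apply: is_cderive_near h2; have := fg 'i%C; apply: filterS => t.
by rewrite -scalerA.
Qed.

Lemma is_wirtinger_cst a p c : is_wirtinger a (fun=> c) p 0 0.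
Proof.
by split; rewrite ?subr0 ?mulr0 ?addr0; exact: is_cderive_cst.
Qed.

Lemma is_wirtinger_coord a p : is_wirtinger a (fun q => q 0 a) p 1 0.
Proof.
by split; have := is_cderive_coord;
  [move/(_ (delta_mx 0 a) p a)|move/(_ ('i%C *: delta_mx 0 a) p a)];
  rewrite !mxE !eqxx ?mulr1 ?subr0 ?addr0 ?mulr1.
Qed.

Lemma is_wirtinger_conjcoord a p : is_wirtinger a (fun q => (q 0 a)^*%R) p 0 1.
Proof.
have ci : ('i%C : R[i])^*%R = - 'i%C.
  by apply/eqP; rewrite eq_complex /= oppr0 !eqxx.
split; have := is_cderive_conj (is_cderive_coord _ p a).
  by move/(_ (delta_mx 0 a)); rewrite !mxE !eqxx conjC1 add0r.
by move/(_ ('i%C *: delta_mx 0 a)); rewrite !mxE !eqxx mulr1 ci sub0r mulrN1.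
Qed.

Lemma is_wirtingerM a f g p l l' k k' :
  is_wirtinger a f p l l' -> is_wirtinger a g p k k' ->
  is_wirtinger a (fun q => f q * g q) p
    (l * g p + f p * k) (l' * g p + f p * k').
Proof.
case=> f1 f2 [g1 g2]; split.
  have := is_cderiveM f1 g1; congr is_cderive; ring.
have := is_cderiveM f2 g2; congr is_cderive; ring.
Qed.

Lemma is_wirtinger_radial a p (phi : R -> R) d :
  has_deriv phi (sqnorm (p 0 a)) d ->
  is_wirtinger a (fun q => (phi (sqnorm (q 0 a)))%:C) p
    (d%:C * (p 0 a)^*%R) (d%:C * p 0 a).
Proof.
move=> h; split.
  have := is_cderive_radial (delta_mx 0 a) h; congr is_cderive.
  rewrite !mxE !eqxx /= mul1r Re_conj; case: (p 0 a) => x y.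
  by apply/eqP; rewrite eq_complex /=; apply/andP; split; apply/eqP; ring.
have := is_cderive_radial ('i%C *: delta_mx 0 a) h; congr is_cderive.
rewrite !mxE !eqxx /= mulr1 ReM Re_conj Im_conj; case: (p 0 a) => x y.
by apply/eqP; rewrite eq_complex /=; apply/andP; split; apply/eqP; ring.
Qed.

End WirtingerCalculus.

(** * Curvature along a complex line on which the metric is radial *)

Section RadialCurvature.
Variables (R : realType) (m : nat).
Implicit Types (p q : 'rV[R[i]]_m) (H : 'rV[R[i]]_m -> 'M[R[i]]_m).

(** If d/dz_i multiplies row i of the metric by [lam], its product with the inverse matrix is [lam]
    times a unit vector, and the double sum in [riem] collapses to the term s = i. *)
Lemma riem_line H p i (lam : R[i]) : H p \in unitmx ->
  (forall t, dz i (fun q => H q i t) p = lam * H p i t) ->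
  riem H p i i i i = - dz i (dzbar i (fun q => H q i i)) p
    + lam * dzbar i (fun q => H q i i) p.
Proof.
move=> Hu hrow; rewrite /riem; congr (_ + _).
have key s : \sum_t dz i (fun q => H q i t) p * invmx (H p) t s =
    lam * (i == s)%:R.
  have <- : (H p *m invmx (H p)) i s = (i == s)%:R by rewrite mulmxV // mxE.
  by rewrite mxE mulr_sumr; apply: eq_bigr => t _; rewrite hrow mulrA.
under eq_bigr => s _ do rewrite -mulr_suml key.
rewrite (bigD1 i) //= eqxx mulr1 big1 ?addr0 // => s si.
by rewrite eq_sym (negbTE si) mulr0 mul0r.
Qed.

Lemma sqnorm_line_gt p (v : 'rV[R[i]]_m) i (s0 : R) : s0 < sqnorm (p 0 i) ->
  \forall t \near (0 : R), s0 < sqnorm ((p + t%:C *: v) 0 i).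
Proof.
move=> ps; have /has_deriv_continuous := is_cderive_sqnorm v p i.
by move/cvgr_gt; apply; rewrite line0.
Qed.

(** The value is - phi d dbar log phi at s = |z|^2. The bound [s0] makes the domain of [phi] an open
    half-line: s0 = 0 serves a punctured fiber, and a negative [s0] makes s = 0 an interior
    point. *)
Lemma riem_radial H p i (kap : 'I_m -> R[i]) (s0 : R) (phi phi1 phi2 : R -> R) :
  H p \in unitmx -> s0 < sqnorm (p 0 i) -> phi (sqnorm (p 0 i)) != 0 ->
  (forall s, s0 < s -> has_deriv phi s (phi1 s)) ->
  (forall s, s0 < s -> has_deriv phi1 s (phi2 s)) ->
  (forall c : R[i], let q := p + c *: delta_mx 0 i in
     s0 < sqnorm (q 0 i) ->
     H q i i = (phi (sqnorm (q 0 i)))%:C /\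
     forall b, b != i ->
       H q i b = (phi (sqnorm (q 0 i)))%:C * (q 0 i)^*%R * kap b) ->
  let s := sqnorm (p 0 i) in
  riem H p i i i i = (- (phi1 s + s * phi2 s) + s * phi1 s ^+ 2 / phi s)%:C.
Proof.
move=> Hu ps phi0 d1 d2 hH s.
have line_near q (c : R[i]) : s0 < sqnorm (q 0 i) ->
    \forall t \near (0 : R), s0 < sqnorm ((q + (t%:C * c) *: delta_mx 0 i) 0 i).
  move=> qs; have := sqnorm_line_gt (c *: delta_mx 0 i) qs.
  by apply: filterS => t; rewrite scalerA.
(* The inner derivative [dzbar] has to be known at nearby points of the line before [dz] is applied,
   so the row formula is restated at base points moved along the line. *)
have hHc (c c' : R[i]) : let q := p + c' *: delta_mx 0 i + c *: delta_mx 0 i in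
     s0 < sqnorm (q 0 i) ->
     H q i i = (phi (sqnorm (q 0 i)))%:C /\
     forall b, b != i ->
       H q i b = (phi (sqnorm (q 0 i)))%:C * (q 0 i)^*%R * kap b.
  by rewrite -addrA -scalerDl; exact: hH.
have w1 (c : R[i]) : let q := p + c *: delta_mx 0 i in s0 < sqnorm (q 0 i) ->
    is_wirtinger i (fun q => H q i i) q
      ((phi1 (sqnorm (q 0 i)))%:C * (q 0 i)^*%R)
      ((phi1 (sqnorm (q 0 i)))%:C * q 0 i).
  move=> q qs; apply: wirtinger_near (is_wirtinger_radial (d1 _ qs)) => c'.
  have := line_near q c' qs; apply: filterS => t ts.
  by have [-> _] := hHc _ _ ts.
have p0 : p = p + 0 *: delta_mx 0 i by rewrite scale0r addr0.
have hp := hH 0; rewrite /= -p0 in hp; have [Hpii Hpib] := hp ps.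
have w1p := w1 0; rewrite /= -p0 in w1p.
have phiC : (phi s)%:C != 0 :> R[i] by rewrite realC_neq0 phi0.
(* Both zbar and [kap] are killed by d/dz, so all entries of the row have the logarithmic derivative
   of [phi], which is this factor. *)
rewrite (@riem_line _ _ _ ((phi1 s)%:C * (p 0 i)^*%R / (phi s)%:C)) //; last first.
  move=> t; have [->|ti] := eqVneq t i.
    by rewrite (wirtinger_dz (w1p ps)) Hpii -/s divfK.
  rewrite Hpib // -/s.
  have w3 := is_wirtingerM (is_wirtingerM (is_wirtinger_radial (d1 _ ps))
    (is_wirtinger_conjcoord i p)) (is_wirtinger_cst i p (kap t)).
  have := wirtinger_dz (wirtinger_near _ w3) => ->.
    by rewrite -/s; field.
  move=> c; have := line_near p c ps; apply: filterS => u us.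
  by have [_ ->] := hH _ us.
rewrite (wirtinger_dzbar (w1p ps)).
have w2 := is_wirtingerM (is_wirtinger_radial (d2 _ ps)) (is_wirtinger_coord i p).
have := wirtinger_dz (wirtinger_near _ w2) => ->; last first.
  move=> c; have := line_near p c ps; apply: filterS => u us.
  by rewrite (wirtinger_dzbar (w1 _ us)).
rewrite -/s !rmorphD !rmorphN !rmorphM !fmorphV rmorphD rmorphM /= /s sqnormE.
by field; rewrite -/s.
Qed.

End RadialCurvature.

(** * Hermitian forms and unitary reflections *)

Section HermitianForms.
Variables (R : realType) (m : nat).
Implicit Types (x y v X Y Z : 'rV[R[i]]_m) (H : 'M[R[i]]_m) (c : R[i]).

Lemma sformE H X Y : sform H X Y = \sum_a \sum_b X 0 a * H a b * (Y 0 b)^*%R.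
Proof.
rewrite /sform mxE exchange_big /=; apply: eq_bigr => b _.
by rewrite !mxE mulr_suml.
Qed.

Lemma sformDl H X Y Z : sform H (X + Y) Z = sform H X Z + sform H Y Z.
Proof. by rewrite /sform !mulmxDl mxE. Qed.

Lemma sformZl H c X Y : sform H (c *: X) Y = c * sform H X Y.
Proof. by rewrite /sform -!scalemxAl mxE. Qed.

Lemma sformDr H X Y Z : sform H X (Y + Z) = sform H X Y + sform H X Z.
Proof. by rewrite /sform linearD /= map_mxD mulmxDr mxE. Qed.

Lemma sformZr H c X Y : sform H X (c *: Y) = c^*%R * sform H X Y.
Proof. by rewrite /sform linearZ /= map_mxZ -scalemxAr mxE. Qed.

Lemma sform_delta H a b : sform H (delta_mx 0 a) (delta_mx 0 b) = H a b.
Proof.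
rewrite sformE (bigD1 a) //= (bigD1 b) //= !mxE !eqxx conjC1 mul1r mulr1.
rewrite !big1 ?addr0 // => [c ca|c cb].
  by rewrite big1 // => d _; rewrite !mxE eqxx (negbTE ca) !mul0r.
by rewrite !mxE eqxx (negbTE cb) conjC0 mulr0.
Qed.

Lemma sform_scale H c X Y : sform (c *: H) X Y = c * sform H X Y.
Proof. by rewrite /sform -scalemxAr -scalemxAl mxE. Qed.

Lemma sform_mul m' H (T : 'M[R[i]]_(m', m)) (X Y : 'rV[R[i]]_m') :
  sform (T *m H *m T^t*) X Y = sform H (X *m T) (Y *m T).
Proof. by rewrite /sform trmx_mul map_mxM !mulmxA. Qed.

Lemma sform_conj H X Y : H^t* = H -> sform H Y X = (sform H X Y)^*%R.
Proof.
move=> hH; rewrite !sformE rmorph_sum exchange_big /=; apply: eq_bigr => a _.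
rewrite rmorph_sum; apply: eq_bigr => b _ /=.
rewrite !rmorphM /= conjCK -[in LHS]hH !mxE.
by rewrite mulrC mulrA mulrAC.
Qed.

(** Cauchy-Schwarz for a semidefinite form. It turns [kahler_null], which speaks of diagonal values,
    into the vanishing of the metric with an orbit direction in either slot. *)
Lemma sform_isotropic H X Y : H^t* = H -> (forall Z, 0 <= sform H Z Z) ->
  sform H X X = 0 -> sform H X Y = 0.
Proof.
move=> hH h0 hX; set s := sform H X Y.
(* The form is nonnegative at [Y - u s^* X] for every real [u]. *)
have hYX : sform H Y X = s^*%R by exact: sform_conj.
have key (u : R) : 0 <= complex.Re (sform H Y Y) - 2 * u * sqnorm s.
  have := h0 ((- u%:C * s^*%R) *: X + Y).
  rewrite sformDl !sformDr !sformZl !sformZr hX mulr0 mulr0 add0r hYX -/s.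
  rewrite rmorphM rmorphN /= conjCK lecE => /andP[_].
  have -> : (u%:C)^*%R = u%:C :> R[i] by exact: conjc_real.
  set S := sform H Y Y; congr (_ <= _); rewrite !ReD !ReM.
  by case: s {hYX} => a b; rewrite /sqnorm /=; ring.
apply/eqP; rewrite -sqnorm_eq0; apply/eqP/le_anti; rewrite sqnorm_ge0 andbT.
rewrite leNgt; apply/negP => sp.
(* For this u the quantity in [key] equals -1. *)
have := key ((complex.Re (sform H Y Y) + 1) / (2 * sqnorm s)).
have -> : 2 * ((complex.Re (sform H Y Y) + 1) / (2 * sqnorm s)) * sqnorm s
  = complex.Re (sform H Y Y) + 1 by field; rewrite gt_eqF.
lra.
Qed.

Definition hdot x y : R[i] := (x *m y^t*) 0 0.
Definition hsq x : R := \sum_a sqnorm (x 0 a).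

Lemma hdotE x y : hdot x y = \sum_a x 0 a * (y 0 a)^*%R.
Proof. by rewrite /hdot mxE; apply: eq_bigr => a _; rewrite !mxE. Qed.

Lemma hdotDl x y v : hdot (x + y) v = hdot x v + hdot y v.
Proof. by rewrite /hdot mulmxDl mxE. Qed.

Lemma hdotZl c x y : hdot (c *: x) y = c * hdot x y.
Proof. by rewrite /hdot -scalemxAl mxE. Qed.

Lemma hdotC x y : hdot y x = (hdot x y)^*%R.
Proof.
rewrite !hdotE rmorph_sum; apply: eq_bigr => a _.
by rewrite rmorphM /= conjCK mulrC.
Qed.

Lemma hdotDr x y v : hdot x (y + v) = hdot x y + hdot x v.
Proof. by rewrite hdotC hdotDl rmorphD /= -!hdotC. Qed.

Lemma hdotZr c x y : hdot x (c *: y) = c^*%R * hdot x y.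
Proof. by rewrite hdotC hdotZl rmorphM /= -hdotC. Qed.

Lemma hdotNl x y : hdot (- x) y = - hdot x y.
Proof. by rewrite -scaleN1r hdotZl mulN1r. Qed.

Lemma hdotNr x y : hdot x (- y) = - hdot x y.
Proof. by rewrite hdotC hdotNl rmorphN /= -hdotC. Qed.

Lemma hdot0l x : hdot 0 x = 0.
Proof. by rewrite -(scale0r x) hdotZl mul0r. Qed.

Lemma hdot0r x : hdot x 0 = 0.
Proof. by rewrite hdotC hdot0l conjC0. Qed.

Lemma hdot_delta x a : hdot x (delta_mx 0 a) = x 0 a.
Proof.
rewrite hdotE (bigD1 a) //= big1 ?addr0 => [|b ba].
  by rewrite !mxE !eqxx conjC1 mulr1.
by rewrite !mxE (negbTE ba) conjC0 mulr0.
Qed.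

Lemma hdotxx x : hdot x x = (hsq x)%:C.
Proof.
by rewrite hdotE /hsq rmorph_sum; apply: eq_bigr => a _; rewrite -sqnormE.
Qed.

Lemma hsq_ge0 x : 0 <= hsq x.
Proof. by rewrite sumr_ge0 // => a _; exact: sqnorm_ge0. Qed.

Lemma hsq_eq0 x : (hsq x == 0) = (x == 0).
Proof.
apply/idP/eqP => [|->]; last first.
  by rewrite /hsq big1 // => a _; rewrite mxE sqnorm0.
rewrite /hsq psumr_eq0 => [/allP h|a _]; last exact: sqnorm_ge0.
apply/rowP => a; have := h a (mem_index_enum _).
by rewrite sqnorm_eq0 mxE => /eqP.
Qed.

Lemma hsq_gt0 x : (0 < hsq x) = (x != 0).
Proof. by rewrite lt_def hsq_ge0 hsq_eq0 andbT. Qed.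

Lemma hsqZ c x : hsq (c *: x) = sqnorm c * hsq x.
Proof. by rewrite /hsq mulr_sumr; apply: eq_bigr => a _; rewrite mxE sqnormM. Qed.

Lemma enorm_sqrt x : enorm x = Num.sqrt (hsq x).
Proof.
congr Num.sqrt; apply: eq_bigr => a _.
by rewrite normc_sqnorm sqr_sqrtr // sqnorm_ge0.
Qed.

Lemma hdot_unitary (u : 'M[R[i]]_m) x y : u \is unitarymx ->
  hdot (x *m u) (y *m u) = hdot x y.
Proof.
move=> /unitarymxP hu.
by rewrite /hdot trmx_mul map_mxM mulmxA -(mulmxA x) hu mulmx1.
Qed.

Lemma hsq_unitary (u : 'M[R[i]]_m) x : u \is unitarymx -> hsq (x *m u) = hsq x.
Proof.
by move=> hu; apply: (@complexI R); rewrite -!hdotxx hdot_unitary.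
Qed.

(** The Householder reflection in the complex hyperplane orthogonal to v, acting on rows from the
    right. *)
Definition reflection v : 'M[R[i]]_m :=
  1%:M - (2 / hsq v)%:C *: (v^t* *m v).

Lemma mul_reflection x v :
  x *m reflection v = x - ((2 / hsq v)%:C * hdot x v) *: v.
Proof.
rewrite mulmxBr mulmx1 -scalemxAr mulmxA; congr (_ - _).
by rewrite [x *m _]mx11_scalar -/(hdot x v) mul_scalar_mx scalerA.
Qed.

(** Being self-adjoint, the reflection is unitary as soon as it is an involution; the coefficient of
    v in its square contains the factor c |v|^2 - 2 = 0. *)
Lemma reflection_unitary v : v != 0 -> reflection v \is unitarymx.
Proof.
move=> v0; apply/unitarymxP.
have q0 : hsq v != 0 by rewrite hsq_eq0.
set c := (2 / hsq v)%:C.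
have cc : c^*%R = c by exact: conjc_real.
have -> : (reflection v)^t* = reflection v.
  rewrite /reflection linearB linearZ /= map_mxB map_mxZ trmx_mul map_mxM /=.
  by rewrite trmx1 map_mx1 -/c cc -map_trmx trmxK map_mxCK.
apply/row_matrixP => i; rewrite row_mul row1 rowE.
rewrite !mul_reflection hdotDl -!scaleNr hdotZl hdotxx -/c.
rewrite -addrA -scalerDl; set d := hdot _ v.
have e : c * (hsq v)%:C = 2 by rewrite -rmorphM /= divfK // rmorph_nat.
rewrite (_ : - c *: d + _ = 0) ?scale0r ?addr0 // /GRing.scale /=.
by transitivity (c * d * (c * (hsq v)%:C - 2)); [ring|rewrite e subrr mulr0].
Qed.

End HermitianForms.

(** * Homogeneous coordinates and representatives of the orbits *)

Section HomogeneousCoordinates.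
Variables (R : realType) (n k : nat).
Implicit Types (x xi : 'rV[R[i]]_n) (p X Y : 'rV[R[i]]_(n + 2)) (y z w : R[i]).

Definition hpt x y z : 'rV[R[i]]_(n + 2) :=
  row_mx x (\row_(j < 2) if j == 0 then y else z).

Lemma hx_hpt x y z : hx (hpt x y z) = x.
Proof. exact: row_mxKl. Qed.

Lemma hy0_hpt x y z : hy0 (hpt x y z) = y.
Proof. by rewrite /hy0 row_mxKr mxE. Qed.

Lemma hy1_hpt x y z : hy1 (hpt x y z) = z.
Proof. by rewrite /hy1 row_mxKr mxE. Qed.

Definition hptE := (hx_hpt, hy0_hpt, hy1_hpt).

Lemma hpt_eta p : hpt (hx p) (hy0 p) (hy1 p) = p.
Proof.
rewrite -[RHS]hsubmxK; congr row_mx; apply/rowP => j.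
by rewrite mxE; case: j => [[|[|//]] hj] /=; congr (rsubmx p 0 _); exact: val_inj.
Qed.

Lemma hptD x y z xi w z' : hpt x y z + hpt xi w z' = hpt (x + xi) (y + w) (z + z').
Proof.
rewrite /hpt add_row_mx; congr row_mx; apply/rowP => j; rewrite !mxE.
by case: ifP.
Qed.

Lemma hptZ c x y z : c *: hpt x y z = hpt (c *: x) (c * y) (c * z).
Proof.
rewrite /hpt scale_row_mx; congr row_mx; apply/rowP => j; rewrite !mxE.
by case: ifP.
Qed.

Lemma hpt_unitary x y z (u : 'M[R[i]]_n) :
  hpt x y z *m unitary_mx u = hpt (x *m u) y z.
Proof. by rewrite mul_row_block !mulmx0 mulmx1 addr0 add0r. Qed.

Lemma hpt_torus x y z lam mu :
  hpt x y z *m torus_mx n k lam mu = hpt (lam *: x) (mu * lam ^- k * y) (mu * z).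
Proof.
apply/rowP => j; rewrite mul_mx_diag !mxE.
case: (fintype.split j) => l; rewrite !mxE; first by rewrite mulrC.
by case: ifP; rewrite mulrC.
Qed.

Lemma homog_hpt x y z : x != 0 -> (y != 0) || (z != 0) -> homog (hpt x y z).
Proof.
move=> x0 yz; split; first by rewrite hx_hpt.
rewrite /=; apply: contraNneq (_ : ~~ ((y == 0) && (z == 0))) => [h|]; last first.
  by rewrite negb_and.
have := hy0_hpt x y z; have := hy1_hpt x y z.
by rewrite /hy0 /hy1 h !mxE => <- <-; rewrite eqxx.
Qed.

Lemma homog_star_hpt x y z : x != 0 -> y != 0 -> z != 0 ->
  homog_star (hpt x y z).
Proof. by rewrite /homog_star /= !hptE. Qed.

Lemma homog_star_homog p : homog_star p -> homog p.
Proof.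
rewrite -(hpt_eta p) => -[]; rewrite !hptE => x0 y0 _.
by apply: homog_hpt; rewrite ?y0.
Qed.

Lemma rad_hpt x y z :
  rad k (hpt x y z) = Num.sqrt (sqnorm y / sqnorm z) * Num.sqrt (hsq x) ^+ k.
Proof. by rewrite /rad !hptE normc_sqnorm sqnormM sqnormV enorm_sqrt. Qed.

Lemma rad_gt0 p : homog_star p -> 0 < rad k p.
Proof.
rewrite -(hpt_eta p) => -[]; rewrite !hptE => x0 y0 z0.
by rewrite rad_hpt mulr_gt0 ?exprn_gt0 ?sqrtr_gt0 ?divr_gt0 ?sqnorm_gt0 ?hsq_gt0.
Qed.

(** The reflection along x - y exchanges x and y if they have equal norms and a real inner product;
    the phase [w] makes the inner product of x with y = w |x| e_i real. Vectors orthogonal to x and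
    e_i are fixed, which later keeps the base point in place while another direction is rotated. *)
Lemma unitary_align x (i : 'I_n) : exists2 u : 'M[R[i]]_n, u \is unitarymx &
  (exists2 w, sqnorm w = 1 &
     x *m u = (w * (Num.sqrt (hsq x))%:C) *: delta_mx 0 i) /\
  forall z : 'rV[R[i]]_n, hdot z x = 0 -> z 0 i = 0 -> z *m u = z.
Proof.
set e := Num.sqrt (hsq x).
have e2 : e ^+ 2 = hsq x by rewrite sqr_sqrtr // hsq_ge0.
have [w w1 wx] : exists2 w : R[i], sqnorm w = 1 &
    exists s : R, x 0 i * w^*%R = s%:C.
  have [x0|x0] := eqVneq (x 0 i) 0.
    by exists 1; [exact: sqnorm1|exists 0; rewrite x0 mul0r].
  set s := Num.sqrt (sqnorm (x 0 i)).
  have s0 : s != 0 by rewrite sqrtr_eq0 -ltNge sqnorm_gt0.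
  exists ((s^-1)%:C * x 0 i).
    rewrite sqnormM sqnorm_real exprVn sqr_sqrtr ?sqnorm_ge0 // mulVf //.
    by rewrite sqnorm_eq0.
  exists (s^-1 * sqnorm (x 0 i)); rewrite rmorphM /= rmorphM /= sqnormE mulrCA.
  by congr (_ * _); exact: conjc_real.
have [s hs] := wx.
set y : 'rV[R[i]]_n := (w * e%:C) *: delta_mx 0 i.
have hxy : hdot x y = (e * s)%:C.
  rewrite hdotZr hdot_delta rmorphM /= mulrC mulrA hs rmorphM /= mulrC.
  by congr (_ * _); exact: conjc_real.
have hyy : hsq y = hsq x.
  rewrite hsqZ sqnormM w1 sqnorm_real mul1r e2.
  suff -> : hsq (delta_mx 0 i : 'rV[R[i]]_n) = 1 by rewrite mulr1.
  apply: (@complexI R); rewrite -hdotxx hdot_delta mxE !eqxx.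
  by [].
have [xy|xy] := eqVneq (x - y) 0.
  exists 1%:M; first by apply/unitarymxP; rewrite mul1mx trmx1 map_mx1.
  split; last by move=> z; rewrite mulmx1.
  by exists w => //; rewrite mulmx1; apply/eqP; rewrite -subr_eq0 xy.
exists (reflection (x - y)); first exact: reflection_unitary.
split; last first.
  move=> z zx zi; rewrite mul_reflection hdotDr zx add0r hdotNr.
  by rewrite /y hdotZr hdot_delta zi mulr0 oppr0 mulr0 scale0r subr0.
exists w => //; rewrite mul_reflection.
have hv : hdot x (x - y) = (hsq x - e * s)%:C.
  by rewrite hdotDr hdotxx hdotNr hxy rmorphB.
(* As the inner product of x and y is the real number e s and |y| = |x|, the reflection subtracts
   exactly x - y from x. *)
have q : hsq (x - y) = 2 * (hsq x - e * s).
  apply: (@complexI R); rewrite -hdotxx hdotDl hv hdotNl.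
  rewrite hdotDr (hdotC x y) hxy hdotNr hdotxx hyy.
  have -> : ((e * s)%:C)^*%R = (e * s)%:C :> R[i] by exact: conjc_real.
  by rewrite -!(rmorphN, rmorphD) /=; congr _%:C; ring.
have q0 : hsq (x - y) != 0 by rewrite hsq_eq0.
rewrite hv -rmorphM /=.
have -> : 2 / hsq (x - y) * (hsq x - e * s) = 1.
  by rewrite q; field; move: q0; rewrite q mulf_eq0 negb_or => /andP[].
by rewrite scale1r opprB addrC subrK.
Qed.

(** A real line in the fiber over [e_i] that crosses E_0 at r = 0; r is allowed to be any real
    number so that derivatives at E_0 make sense. *)
Definition base_pt (i : 'I_n) (r : R) := hpt (delta_mx 0 i) r%:C 1.

Lemma delta_neq0 (i : 'I_n) : delta_mx 0 i != 0 :> 'rV[R[i]]_n.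
Proof.
by apply/eqP => /rowP/(_ i); rewrite !mxE !eqxx => /eqP; rewrite oner_eq0.
Qed.

Lemma homog_base_pt i r : homog (base_pt i r).
Proof. by apply: homog_hpt; rewrite ?delta_neq0 // oner_eq0 orbT. Qed.

Lemma orbit_base_pt (i : 'I_n) p : (0 < k)%N -> homog_star p ->
  exists u lam mu, [/\ u \is unitarymx, lam != 0, mu != 0 &
    p *m unitary_mx u *m torus_mx n k lam mu = base_pt i (rad k p)].
Proof.
move=> k0; rewrite -(hpt_eta p); set x := hx p; set y := hy0 p; set z := hy1 p.
move=> -[]; rewrite !hptE => x0 y0 z0.
have [u hu [[w w1 xu] _]] := unitary_align x i.
set e := Num.sqrt (hsq x) in xu.
have e0 : e != 0 by rewrite sqrtr_eq0 -ltNge hsq_gt0.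
have eC : e%:C != 0 :> R[i] by rewrite realC_neq0 e0.
have w0 : w != 0 by rewrite -sqnorm_gt0 w1.
set a := Num.sqrt (sqnorm (y / z)).
have a2 : a ^+ 2 = sqnorm (y / z) by rewrite sqr_sqrtr ?sqnorm_ge0.
have a0 : a != 0.
  by rewrite sqrtr_eq0 -ltNge sqnorm_gt0 mulf_neq0 // invr_eq0.
have aC : a%:C != 0 :> R[i] by rewrite realC_neq0 a0.
(* After x is sent to the axis and y1 to 1, [tau] is the phase left on y0. The torus factor t and
   the scalar unitary t^* cancel on x, while t acts on y0 through t^-k, so a k-th root of [tau]
   makes y0 positive and leaves x alone. This requires k > 0. *)
set tau := y / z * w ^+ k / a%:C.
have tau1 : sqnorm tau = 1.
  rewrite sqnormM sqnormV sqnorm_real a2 sqnormM.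
  by rewrite sqnormX w1 expr1n mulr1 divff // sqnorm_eq0 mulf_neq0 // invr_eq0.
set t := k.-root tau.
have tk : t ^+ k = tau by rewrite /t rootCK.
have t1 : sqnorm t = 1.
  apply/eqP; rewrite -(@pexpr_eq1 _ _ k) // ?sqnorm_ge0 //; apply/eqP.
  by rewrite -sqnormX tk tau1.
have t0 : t != 0 by rewrite -sqnorm_gt0 t1.
have tt : t * t^*%R = 1 by rewrite -sqnormE t1.
exists (t^*%R *: u), (t / (w * e%:C)), z^-1; split.
- apply/unitarymxP; rewrite linearZ /= map_mxZ -scalemxAl -scalemxAr scalerA.
  by rewrite /= conjCK mulrC tt scale1r; exact/unitarymxP.
- by rewrite mulf_neq0 // invr_eq0 mulf_neq0.
- by rewrite invr_eq0.
rewrite hpt_unitary hpt_torus -scalemxAr xu !scalerA mulVf // /base_pt.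
congr hpt.
  have -> : t / (w * e%:C) * t^*%R * (w * e%:C) = t * t^*%R.
    by field; rewrite ?w0 ?eC.
  by rewrite tt scale1r.
rewrite rad_hpt -/e -sqnormV -sqnormM -/a rmorphM rmorphXn /=.
rewrite expr_div_n exprMn tk invf_div /tau.
by field; apply/and4P; split => //; exact: expf_neq0.
Qed.

(** The sesquilinear form of d dbar log |x|^2; [fubini_study] is its diagonal times 2n. *)
Definition fs_form p X Y : R[i] :=
  hdot (hx X) (hx Y) / (hsq (hx p))%:C
  - hdot (hx X) (hx p) * hdot (hx p) (hx Y) / (hsq (hx p) ^+ 2)%:C.

(* The pullback of d log (v^2), for v the fiber coordinate of H^-k. *)
Definition log_form p X : R[i] :=
  hy0 X / hy0 p - hy1 X / hy1 p
  + k%:R * hdot (hx X) (hx p) / (hsq (hx p))%:C.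

End HomogeneousCoordinates.

(** * Structure of the invariant metrics on L^* *)

Section InvariantMetrics.
Variables (R : realType) (n k : nat) (i0 i1 : 'I_n).
Hypotheses (k_gt0 : (0 < k)%N) (i10 : i1 != i0).
Variable G : 'rV[R[i]]_(n + 2) -> 'M[R[i]]_(n + 2).
Hypothesis hG : unitary_kahler_metric k G.
Implicit Types (x xi : 'rV[R[i]]_n) (p X Y : 'rV[R[i]]_(n + 2)).

Lemma delta_hpt_x l :
  delta_mx 0 (lshift 2 l) = hpt (delta_mx 0 l) 0 0 :> 'rV[R[i]]_(n + 2).
Proof.
apply/rowP => j; rewrite !mxE eqxx /=.
case: (splitP j) => l' hl; rewrite !mxE.
  by rewrite -!(inj_eq val_inj) /= hl.
by case: ifP => _; rewrite -!(inj_eq val_inj) /= hl gtn_eqF // ltn_addr.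
Qed.

Lemma delta_hpt_y0 : delta_mx 0 (rshift n 0) = hpt 0 1 0 :> 'rV[R[i]]_(n + 2).
Proof.
apply/rowP => j; rewrite !mxE eqxx /=.
case: (splitP j) => l hl; rewrite !mxE -(inj_eq val_inj) /= hl.
  by rewrite ltn_eqF // addn0.
by rewrite eqn_add2l -(inj_eq val_inj); case: ifP.
Qed.

Lemma delta_hpt_y1 : delta_mx 0 (rshift n 1) = hpt 0 0 1 :> 'rV[R[i]]_(n + 2).
Proof.
apply/rowP => j; rewrite !mxE eqxx /=.
case: (splitP j) => l hl; rewrite !mxE -(inj_eq val_inj) /= hl.
  by rewrite ltn_eqF // ltn_addr.
by rewrite eqn_add2l -(inj_eq val_inj); case: l {hl} => -[|[|//]].
Qed.

Lemma metric_unitary p X Y u : homog p -> u \is unitarymx ->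
  sform (G p) X Y =
  sform (G (p *m unitary_mx u)) (X *m unitary_mx u) (Y *m unitary_mx u).
Proof. by move=> hp hu; rewrite -sform_mul (hG.2 _ hu). Qed.

Lemma metric_torus p X Y lam mu : homog p -> lam != 0 -> mu != 0 ->
  sform (G p) X Y = sform (G (p *m torus_mx n k lam mu))
    (X *m torus_mx n k lam mu) (Y *m torus_mx n k lam mu).
Proof. by move=> hp l0 m0; rewrite -sform_mul (kahler_torus hG.1 l0 m0). Qed.

Lemma metric_orbit_l p X Y : homog p -> orbit_tangent k p X ->
  sform (G p) X Y = 0.
Proof.
move=> hp hX; apply: sform_isotropic; first exact: kahler_herm hG.1 _ hp.
  by move=> Z; exact: kahler_ge0 hG.1 _ _ hp.
exact/(kahler_null hG.1).
Qed.

Lemma metric_orbit_r p X Y : homog p -> orbit_tangent k p Y ->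
  sform (G p) X Y = 0.
Proof.
move=> hp hY; rewrite (sform_conj _ _ (kahler_herm hG.1 hp)).
by rewrite metric_orbit_l // conjC0.
Qed.

Lemma metric_real p X : homog p ->
  sform (G p) X X = (complex.Re (sform (G p) X X))%:C.
Proof.
move=> hp; have := kahler_ge0 hG.1 X hp; case: (sform _ _ _) => a b.
by rewrite lecE /= => /andP[/eqP-> _].
Qed.

Local Notation bp := (base_pt i0).
Let bp_homog r := homog_base_pt (R := R) i0 r.

(** The function a, measured along one axis orthogonal to e_{i0}; [fiber_coeff] is h. *)
Definition base_coeff r := complex.Re
  (sform (G (bp r)) (hpt (delta_mx 0 i1) 0 0) (hpt (delta_mx 0 i1) 0 0)).
Definition fiber_coeff r := complex.Re (sform (G (bp r)) (hpt 0 1 0) (hpt 0 1 0)).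

(** The reflection along xi fixes the base point and Y and reverses xi, so the value equals its own
    opposite. *)
Lemma metric_base_cross r xi Y : xi 0 i0 = 0 -> hdot (hx Y) xi = 0 ->
  sform (G (bp r)) (hpt xi 0 0) Y = 0.
Proof.
move=> xi0 hY; have [->|x0] := eqVneq xi 0.
  have -> : hpt 0 0 0 = 0 *: hpt xi 0 0 by rewrite hptZ scale0r mul0r.
  by rewrite sformZl mul0r.
have := metric_unitary (hpt xi 0 0) Y (bp_homog r) (reflection_unitary x0).
rewrite /base_pt -[Y in X in _ = X -> _]hpt_eta !hpt_unitary !mul_reflection.
rewrite hdotC hdot_delta xi0 conjC0 mulr0 scale0r subr0 hY mulr0 scale0r subr0.
rewrite hpt_eta hdotxx -rmorphM /= divfK ?hsq_eq0 //.
have -> : xi - (2 : R)%:C *: xi = - xi.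
  by rewrite rmorph_nat scaler_nat mulr2n opprD addrA subrr add0r.
have -> : hpt (- xi) 0 0 = (-1) *: hpt xi 0 0 by rewrite hptZ mulr0 scaleN1r.
rewrite sformZl mulN1r => /eqP; rewrite -addr_eq0 -mulr2n -mulr_natr mulf_eq0.
by rewrite pnatr_eq0 orbF => /eqP.
Qed.

(** A unitary map taking xi to a multiple of e_{i1} can be chosen to fix e_{i0}, hence the base
    point; the phase [w] disappears from the Hermitian square. *)
Lemma metric_base_diag r xi : xi 0 i0 = 0 ->
  sform (G (bp r)) (hpt xi 0 0) (hpt xi 0 0) = (base_coeff r * hsq xi)%:C.
Proof.
move=> xi0; have [u hu [[w w1 xu] hz]] := unitary_align xi i1.
rewrite (metric_unitary _ _ (bp_homog r) hu) !hpt_unitary hz; last first.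
- by rewrite mxE (negbTE i10) andbF.
- by rewrite hdotC hdot_delta xi0 conjC0.
rewrite xu; set c := w * _.
have -> : hpt (c *: delta_mx 0 i1) 0 0 = c *: hpt (delta_mx 0 i1) 0 0.
  by rewrite hptZ mulr0.
rewrite sformZl sformZr mulrA -sqnormE /c sqnormM w1 sqnorm_real mul1r.
rewrite sqr_sqrtr ?hsq_ge0 // -/(bp r) metric_real //.
by rewrite -/(base_coeff r) rmorphM mulrC.
Qed.

(** Split xi' into its component along xi and a remainder, which [metric_base_cross] kills. *)
Lemma metric_base_perp r xi xi' : xi 0 i0 = 0 -> xi' 0 i0 = 0 ->
  sform (G (bp r)) (hpt xi 0 0) (hpt xi' 0 0) = (base_coeff r)%:C * hdot xi xi'.
Proof.
move=> h h'; have [->|x0] := eqVneq xi 0.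
  by rewrite metric_base_cross ?mxE ?hdot0r // hdot0l mulr0.
set c := hdot xi' xi / (hsq xi)%:C.
have q0 : (hsq xi)%:C != 0 :> R[i] by rewrite realC_neq0 hsq_eq0 x0.
have -> : hpt xi' 0 0 = c *: hpt xi 0 0 + hpt (xi' - c *: xi) 0 0.
  by rewrite hptZ hptD !mulr0 !addr0 addrC subrK.
rewrite sformDr sformZr metric_base_diag // metric_base_cross //; last first.
  by rewrite hx_hpt hdotDl hdotNl hdotZl hdotxx divfK // subrr.
rewrite addr0 (hdotC xi') /c rmorphM fmorphV /= rmorphM /=.
have -> : ((hsq xi)%:C)^*%R = (hsq xi)%:C :> R[i] by exact: conjc_real.
by field.
Qed.

Lemma metric_base r X Y : r != 0 ->
  sform (G (bp r)) X Y = (base_coeff r)%:C * fs_form (bp r) X Y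
   + (r ^+ 2 * fiber_coeff r)%:C
     * (log_form k (bp r) X * (log_form k (bp r) Y)^*%R).
Proof.
move=> r0; have rC : r%:C != 0 :> R[i] by rewrite realC_neq0 r0.
have e1 : hsq (delta_mx 0 i0 : 'rV[R[i]]_n) = 1.
  by apply: (@complexI R); rewrite -hdotxx hdot_delta mxE !eqxx.
pose perp X : 'rV[R[i]]_n := hx X - hx X 0 i0 *: delta_mx 0 i0.
have perp0 Z : perp Z 0 i0 = 0 by rewrite !mxE !eqxx mulr1 subrr.
(* An orbit direction can be chosen to cancel the components on e_{i0} and y1; what it leaves on y0
   is r times [log_form]. This is how [log_form] and the factor r^2 arise. *)
have dec Z : exists2 O, orbit_tangent k (bp r) O &
    Z = O + (hpt (perp Z) 0 0 + (r%:C * log_form k (bp r) Z) *: hpt 0 1 0).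
  exists (hpt (hx Z 0 i0 *: delta_mx 0 i0)
            ((hy1 Z - k%:R * hx Z 0 i0) * r%:C) (hy1 Z * 1)).
    by exists (hx Z 0 i0), (hy1 Z); rewrite /base_pt !hptE.
  rewrite hptZ !hptD -[LHS]hpt_eta /log_form /base_pt !hptE e1 hdot_delta.
  congr hpt; first by rewrite scaler0 addr0 /perp addrC subrK.
    by field.
  by rewrite mulr0 !addr0 mulr1.
have [Z hZ eX] := dec X; have [W hW eY] := dec Y.
set eta := log_form k (bp r) X in eX; set eta' := log_form k (bp r) Y in eY |- *.
rewrite [in LHS]eX [in LHS]eY sformDl metric_orbit_l // add0r sformDr.
rewrite metric_orbit_r // add0r sformDl !sformDr !sformZl !sformZr.
rewrite metric_base_perp // metric_base_cross //; last first.
  by rewrite hx_hpt hdot0l.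
rewrite (sform_conj (hpt (perp Y) 0 0)); last exact: kahler_herm hG.1 _ _.
rewrite metric_base_cross //; last first.
  by rewrite hx_hpt hdot0l.
rewrite conjC0 !mulr0 addr0 add0r metric_real // -/(fiber_coeff r).
congr (_ * _ + _).
  rewrite /fs_form /base_pt hx_hpt e1 expr1n !invr1 !mulr1 /perp.
  rewrite !(hdotDl, hdotDr, hdotNl, hdotNr, hdotZl, hdotZr) hdotxx e1.
  by rewrite (hdotC (hx Y) (delta_mx 0 i0)) !hdot_delta; ring.
rewrite !(rmorphM, rmorphXn) /=.
have -> : (r%:C)^*%R = r%:C :> R[i] by exact: conjc_real.
by rewrite /eta; ring.
Qed.

Lemma fs_form_unitary p X Y u : u \is unitarymx ->
  fs_form (p *m unitary_mx u) (X *m unitary_mx u) (Y *m unitary_mx u)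
  = fs_form p X Y.
Proof.
move=> hu; rewrite -(hpt_eta p) -(hpt_eta X) -(hpt_eta Y) !hpt_unitary.
by rewrite /fs_form !hx_hpt !hdot_unitary // !hsq_unitary.
Qed.

Lemma log_form_unitary p X u : u \is unitarymx ->
  log_form k (p *m unitary_mx u) (X *m unitary_mx u) = log_form k p X.
Proof.
move=> hu; rewrite -(hpt_eta p) -(hpt_eta X) !hpt_unitary.
by rewrite /log_form !hptE !hdot_unitary // !hsq_unitary.
Qed.

Lemma fs_form_torus p X Y lam mu : hx p != 0 -> lam != 0 ->
  fs_form (p *m torus_mx n k lam mu) (X *m torus_mx n k lam mu)
    (Y *m torus_mx n k lam mu) = fs_form p X Y.
Proof.
move=> p0 l0; rewrite -(hpt_eta p) -(hpt_eta X) -(hpt_eta Y) !hpt_torus.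
have q0 : (hsq (hx p))%:C != 0 :> R[i] by rewrite realC_neq0 hsq_eq0 p0.
have lc : lam^*%R != 0 by rewrite conjC_eq0.
rewrite /fs_form !hx_hpt !hdotZl !hdotZr hsqZ !rmorphXn !rmorphM /= sqnormE.
by field; rewrite q0 l0 lc.
Qed.

Lemma log_form_torus p X lam mu : homog_star p -> lam != 0 -> mu != 0 ->
  log_form k (p *m torus_mx n k lam mu) (X *m torus_mx n k lam mu)
  = log_form k p X.
Proof.
rewrite -(hpt_eta p) -(hpt_eta X) !hpt_torus => -[]; rewrite !hptE => x0 y0 z0 l0 m0.
have q0 : (hsq (hx p))%:C != 0 :> R[i] by rewrite realC_neq0 hsq_eq0 x0.
have lc : lam^*%R != 0 by rewrite conjC_eq0.
have lk : lam ^- k != 0 by rewrite invr_eq0 expf_neq0.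
rewrite /log_form !hptE !hdotZl !hdotZr hsqZ !rmorphM /= sqnormE.
set L := lam ^- k in lk *.
by field; rewrite q0 l0 lc m0 lk y0 z0.
Qed.

Lemma homog_star_unitary p u : homog_star p -> u \is unitarymx ->
  homog_star (p *m unitary_mx u).
Proof.
rewrite -(hpt_eta p) hpt_unitary => -[]; rewrite !hptE => x0 y0 z0 hu.
by apply: homog_star_hpt => //; rewrite -hsq_eq0 hsq_unitary // hsq_eq0.
Qed.

(** Both forms on the right are invariant under U(n) and the torus, so the identity is carried over
    from the base point of the orbit. *)
Lemma metric_structure p X Y : homog_star p ->
  sform (G p) X Y = (base_coeff (rad k p))%:C * fs_form p X Y
   + (rad k p ^+ 2 * fiber_coeff (rad k p))%:C
     * (log_form k p X * (log_form k p Y)^*%R).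
Proof.
move=> hp; have [u [lam [mu [hu l0 m0 e]]]] := orbit_base_pt i0 k_gt0 hp.
have hpu := homog_star_unitary hp hu.
rewrite (metric_unitary _ _ (homog_star_homog hp) hu).
rewrite (metric_torus _ _ (homog_star_homog hpu) l0 m0) e.
rewrite metric_base ?gt_eqF ?rad_gt0 // -e.
rewrite fs_form_torus //; last by case: hpu.
by rewrite !log_form_torus // fs_form_unitary // !log_form_unitary.
Qed.

End InvariantMetrics.

(** * Regularity of a and h, and the equation given by closedness *)

Section Regularity.
Variables (R : realType) (m : nat).
Implicit Types (D : set 'rV[R[i]]_m) (f : 'rV[R[i]]_m -> R[i]).
Implicit Types p v : 'rV[R[i]]_m.

Lemma smooth_line D f p v vs : smooth_on D f ->
  (forall t : R, D (p + t%:C *: v)) -> forall t : R,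
  has_deriv (fun t => complex.Re (foldr (@cderive R m) f vs (p + t%:C *: v))) t
    (complex.Re (foldr (@cderive R m) f (v :: vs) (p + t%:C *: v))).
Proof.
move=> hf hD t; apply/has_deriv_shift.
have [_ /(_ v) /cderivable_is [hr _]] := hf vs _ (hD t).
by under eq_fun do rewrite rmorphD scalerDl addrA.
Qed.

Lemma Re_dz a f p : complex.Re (dz a f p) =
  (complex.Re (cderive (delta_mx 0 a) f p)
   + complex.Im (cderive ('i%C *: delta_mx 0 a) f p)) / 2.
Proof.
rewrite /dz; set u := cderive _ _ _; set w := cderive _ _ _.
have -> : (u - 'i%C * w) / 2 = (2^-1)%:C * (u - 'i%C * w).
  by rewrite mulrC fmorphV rmorph_nat.
rewrite ReMr mulrC; congr (_ / _).
by case: u w => a1 b1 [c1 d1] /=; ring.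
Qed.

End Regularity.

Section InvariantMetricsODE.
Variables (R : realType) (n k : nat) (i0 i1 : 'I_n).
Hypotheses (k_gt0 : (0 < k)%N) (i10 : i1 != i0).
Variable G : 'rV[R[i]]_(n + 2) -> 'M[R[i]]_(n + 2).
Hypothesis hG : unitary_kahler_metric k G.

Local Notation a_ := (base_coeff i0 i1 G).
Local Notation h_ := (fiber_coeff i0 G).
Local Notation bp := (base_pt i0).

Lemma base_ptE (r : R) : bp r = hpt (delta_mx 0 i0) 0 1 + r%:C *: hpt 0 1 0.
Proof. by rewrite hptZ hptD scaler0 !addr0 mulr1 mulr0 add0r addr0. Qed.

Lemma base_coeffE : a_ = fun r : R =>
  complex.Re (G (hpt (delta_mx 0 i0) 0 1 + r%:C *: hpt 0 1 0)
    (lshift 2 i1) (lshift 2 i1)).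
Proof.
by apply/funext => r; rewrite -base_ptE /base_coeff -delta_hpt_x sform_delta.
Qed.

Lemma fiber_coeffE : h_ = fun r : R =>
  complex.Re (G (hpt (delta_mx 0 i0) 0 1 + r%:C *: hpt 0 1 0)
    (rshift n 0) (rshift n 0)).
Proof.
by apply/funext => r; rewrite -base_ptE /fiber_coeff -delta_hpt_y0 sform_delta.
Qed.

Lemma base_line_homog (t : R) :
  homog (hpt (delta_mx 0 i0) 0 1 + t%:C *: hpt 0 1 0).
Proof. by rewrite -base_ptE; exact: homog_base_pt. Qed.

(** Allowing r = 0, a point of E_0, supplies the initial values for the later integrations. *)
Lemma fiber_coeff_smooth : exists h1 h2 : R -> R, forall r,
  has_deriv h_ r (h1 r) /\ has_deriv h1 r (h2 r).
Proof.
have sG := kahler_smooth hG.1 (rshift n 0) (rshift n 0).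
have d := smooth_line _ sG base_line_homog.
eexists; eexists => r; split; last exact: d [:: hpt 0 1 0] r.
by rewrite fiber_coeffE; exact: d [::] r.
Qed.

Lemma base_coeff_derivable (r : R) : exists l, has_deriv a_ r l.
Proof.
have sG := kahler_smooth hG.1 (lshift 2 i1) (lshift 2 i1).
have d := smooth_line [::] sG base_line_homog.
by eexists; rewrite base_coeffE; exact: d r.
Qed.

(** The line (e_{i0}; 1, t) crosses E_oo at t = 0, so this controls the metric at the far end of the
    fiber. *)
Lemma infinity_continuous (b : 'I_(n + 2)) :
  complex.Re (G (hpt (delta_mx 0 i0) 1 t%:C) b b) @[t --> (0 : R)]
  --> complex.Re (G (hpt (delta_mx 0 i0) 1 0) b b).
Proof.
have sG := kahler_smooth hG.1 b b.
have e (t : R) :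
    hpt (delta_mx 0 i0) 1 t%:C = hpt (delta_mx 0 i0) 1 0 + t%:C *: hpt 0 0 1.
  by rewrite hptZ hptD scaler0 !addr0 mulr1 mulr0 add0r addr0.
have hD (t : R) : homog (hpt (delta_mx 0 i0) 1 0 + t%:C *: hpt 0 0 1).
  by rewrite -e; apply: homog_hpt; rewrite ?delta_neq0 // oner_eq0.
have := has_deriv_continuous (smooth_line [::] sG hD 0).
by rewrite /= -e; under eq_fun do rewrite -e.
Qed.

Lemma hsq_delta (i : 'I_n) : hsq (delta_mx 0 i : 'rV[R[i]]_n) = 1.
Proof. by apply: (@complexI R); rewrite -hdotxx hdot_delta mxE !eqxx. Qed.

Lemma rad_base_pt (r : R) : 0 < r -> rad k (bp r) = r.
Proof.
move=> r0; rewrite rad_hpt hsq_delta sqrtr1 expr1n mulr1 sqnorm_real.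
by rewrite sqnorm1 divr1 sqrtr_sqr ger0_norm // ltW.
Qed.

(** Closedness at the base point. The derivative of the real entry (x_{i1}, x_{i1}) in y_0 is a'/2;
    the entry (y_0, x_{i1}) along x = e_{i0} + z e_{i1} has the form z g(|z|^2), with derivative
    g(0) = k r h at z = 0. *)
Lemma base_coeff_ode (r : R) : 0 < r -> has_deriv a_ r (2 * k%:R * r * h_ r).
Proof.
move=> r0; have rn0 : r != 0 by rewrite gt_eqF.
have rC : r%:C != 0 :> R[i] by rewrite realC_neq0 rn0.
have [l hl] := base_coeff_derivable r.
apply: (has_deriv_eq hl).
have := kahler_closed hG.1 (lshift 2 i1) (lshift 2 i1) (rshift n 0)
  (homog_base_pt i0 r).
move=> /(congr1 (@complex.Re R)).
set W := (X in _ = X); rewrite Re_dz /cderive /=.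
have -> : rderive (delta_mx 0 (rshift n 0))
    (fun q => complex.Re (G q (lshift 2 i1) (lshift 2 i1))) (bp r) = l.
  apply: has_deriv_derive1.
  apply: (@has_deriv_ext _ 0 (fun t => a_ (r + t))); last first.
    exact: (has_deriv_shift r a_ l).1 hl.
  move=> t; rewrite base_coeffE delta_hpt_y0 base_ptE.
  by rewrite rmorphD scalerDl addrA.
(* Diagonal entries are real, so the direction i y_0 contributes nothing to the real part of
   [dz]. *)
have -> : rderive ('i%C *: delta_mx 0 (rshift n 0))
    (fun q => complex.Im (G q (lshift 2 i1) (lshift 2 i1))) (bp r) = 0.
  apply: has_deriv_derive1.
  apply: (@has_deriv_ext _ 0 (fun=> 0)); last exact: has_deriv_cst.
  move=> t; rewrite -sform_delta (metric_real hG) //.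
  rewrite delta_hpt_y0 !hptZ hptD; apply: homog_hpt.
    by rewrite !scaler0 addr0 delta_neq0.
  by rewrite !mulr0 addr0 oner_eq0 orbT.
(* [rho s] is the norm of (e_{i0} + z e_{i1}; r, 1) for s = |z|^2. The value [d] of g'(0) drops out,
   being multiplied by z = 0; its existence justifies the differentiation. *)
pose rho s := r * Num.sqrt (1 + s) ^+ k.
pose g s := rho s ^+ 2 * h_ (rho s) * (k%:R / r) * (1 + s)^-1.
have [d hg] : exists d, has_deriv g 0 d.
  have hrho : has_deriv rho 0 (r * (k%:R * Num.sqrt (1 + 0) ^+ k.-1
      * ((2 * Num.sqrt (1 + 0))^-1 * 1))).
    apply: has_deriv_eq.
      apply: has_derivM (has_deriv_cst 0 r) (has_derivX k _).
      apply: has_deriv_comp (has_derivD (has_deriv_cst 0 1) (has_deriv_id 0)) _.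
      by apply: is_derive1_sqrt; rewrite addr0.
    by rewrite mul0r add0r add0r.
  have [h1 [h2 hh]] := fiber_coeff_smooth.
  eexists; apply: has_derivM.
    apply: has_derivM (has_deriv_cst _ _).
    apply: has_derivM (has_derivX 2 hrho) _.
    by apply: has_deriv_comp hrho _; case: (hh (rho 0)) => + _; exact.
  apply: has_derivV; first by rewrite addr0 oner_eq0.
  exact: has_derivD (has_deriv_cst _ _) (has_deriv_id _).
have q0 : (bp r) 0 (lshift 2 i1) = 0.
  by rewrite /base_pt /hpt row_mxEl mxE (negbTE i10) andbF.
have hg' : has_deriv g (sqnorm ((bp r) 0 (lshift 2 i1))) d.
  by rewrite q0 sqnorm0.
have w := is_wirtingerM (is_wirtinger_coord (lshift 2 i1) (bp r))
  (is_wirtinger_radial hg').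
rewrite /W (wirtinger_dz (wirtinger_near _ w)); last first.
  move=> c; near=> t; move: (t%:C * c) => z.
  set x : 'rV[R[i]]_n := delta_mx 0 i0 + z *: delta_mx 0 i1.
  have -> : bp r + z *: delta_mx 0 (lshift 2 i1) = hpt x r%:C 1.
    by rewrite delta_hpt_x hptZ hptD !mulr0 !addr0.
  have -> : hpt x r%:C 1 0 (lshift 2 i1) = z.
    by rewrite /hpt row_mxEl !mxE (negbTE i10) !eqxx andbF add0r mulr1.
  have hx2 : hsq x = 1 + sqnorm z.
    apply: (@complexI R); rewrite -hdotxx /x !(hdotDl, hdotDr, hdotZl, hdotZr).
    rewrite !hdot_delta !mxE !eqxx (negbTE i10) eq_sym (negbTE i10).
    by rewrite rmorphD /= sqnormE; ring.
  have x0 : x != 0 by rewrite -hsq_gt0 hx2 ltr_pwDl // sqnorm_ge0.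
  have hs : homog_star (hpt x r%:C 1).
    by apply: homog_star_hpt => //; exact: oner_neq0.
  rewrite -sform_delta delta_hpt_y0 delta_hpt_x (metric_structure k_gt0 i10 hG) //.
  have -> : rad k (hpt x r%:C 1) = rho (sqnorm z).
    rewrite rad_hpt hx2 sqnorm_real.
    by rewrite sqnorm1 divr1 sqrtr_sqr ger0_norm // ltW.
  rewrite /fs_form /log_form !hptE !hdot0l !mul0r subr0 mulr0 add0r.
  rewrite hx2 !mulr0 !mul0r !subr0 add0r addr0.
  rewrite hdotC hdot_delta !mxE (negbTE i10) !eqxx andbF add0r mulr1.
  rewrite /g !(rmorphM, fmorphV) /= conjCK.
  have e (y : R) : (y%:C)^*%R = y%:C :> R[i] by exact: conjc_real.
  have -> : ((k%:R : R[i])^*)%R = k%:R by exact: conjc_nat.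
  rewrite e !rmorph_nat.
  have : (1 + sqnorm z)%:C != 0 :> R[i].
    by rewrite realC_neq0 gt_eqF // ltr_pwDl // sqnorm_ge0.
  by move: (1 + sqnorm z)%:C => q hq; field; apply/andP; split.
rewrite q0 mul1r mul0r addr0 /= => /eqP; rewrite addr0.
rewrite sqnorm0 /g /rho addr0 sqrtr1 expr1n mulr1 invr1 mulr1 => /eqP e.
have -> : l = 2 * (l / 2) by field.
by rewrite e; field.
Unshelve. all: by end_near. Qed.

End InvariantMetricsODE.

(** * The differential of the norm function and the form dt *)

Section RadialDerivative.
Variables (R : realType) (n k : nat).
Implicit Types (p X : 'rV[R[i]]_(n + 2)).

Lemma has_deriv_quadratic (a b c : R) :
  has_deriv (fun t => a + t * b + t ^+ 2 * c) 0 b.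
Proof.
apply: has_deriv_eq.
  apply: has_derivD (has_deriv_affine 0 a b) _.
  exact: has_derivM (has_derivX 2 (has_deriv_id 0)) (has_deriv_cst 0 c).
by rewrite /=; ring.
Qed.

Lemma has_deriv_sqnorm (z w : R[i]) :
  has_deriv (fun t : R => sqnorm (z + t%:C * w)) 0 (2 * complex.Re (w * z^*%R)).
Proof.
apply: has_deriv_ext (has_deriv_quadratic (sqnorm z) _ (sqnorm w)) => t.
by case: z w => a b [c d]; rewrite /sqnorm /=; ring.
Qed.

Lemma has_deriv_hsq m (x xi : 'rV[R[i]]_m) :
  has_deriv (fun t : R => hsq (x + t%:C *: xi)) 0 (2 * complex.Re (hdot xi x)).
Proof.
have re v : hsq v = complex.Re (hdot v v) by rewrite hdotxx.
apply: has_deriv_ext (has_deriv_quadratic (hsq x) _ (hsq xi)) => t.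
rewrite !re !(hdotDl, hdotDr, hdotZl, hdotZr) (hdotC xi x).
have -> : (t%:C)^*%R = t%:C :> R[i] by exact: conjc_real.
by case: (hdot xi x) (hdot xi xi) (hdot x x) => a b [c d] [u v] /=; ring.
Qed.

Lemma Re_div (z w : R[i]) : complex.Re (w / z) = complex.Re (w * z^*%R) / sqnorm z.
Proof.
have -> : w / z = (sqnorm z)^-1%:C * (w * z^*%R).
  have [->|z0] := eqVneq z 0; first by rewrite conjC0 invr0 !mulr0.
  have zc : z^*%R != 0 by rewrite conjC_eq0.
  by rewrite fmorphV /= sqnormE; field; rewrite z0 zc.
by rewrite ReMr mulrC.
Qed.

Lemma hy_line p X (t : R) : p + t%:C *: X =
  hpt (hx p + t%:C *: hx X) (hy0 p + t%:C * hy0 X) (hy1 p + t%:C * hy1 X).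
Proof. by rewrite -[in LHS](hpt_eta p) -[in LHS](hpt_eta X) hptZ hptD. Qed.

(** [log_form] is the (1,0) part of d log r^2, whence d log r = Re [log_form] on real vectors. *)
Lemma has_deriv_rad p X : homog_star p ->
  has_deriv (fun t : R => rad k (p + t%:C *: X)) 0
    (rad k p * complex.Re (log_form k p X)).
Proof.
rewrite -{1}(hpt_eta p) => -[]; rewrite !hptE => x0 y0 z0.
have qx : 0 < hsq (hx p) by rewrite hsq_gt0.
have qy : 0 < sqnorm (hy0 p) by rewrite sqnorm_gt0.
have qz : 0 < sqnorm (hy1 p) by rewrite sqnorm_gt0.
have dx := has_deriv_hsq (hx p) (hx X).
have dy := has_deriv_sqnorm (hy0 p) (hy0 X).
have dz := has_deriv_sqnorm (hy1 p) (hy1 X).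
have x00 : hx p + (0 : R)%:C *: hx X = hx p by rewrite scale0r addr0.
have y00 : hy0 p + (0 : R)%:C * hy0 X = hy0 p by rewrite mul0r addr0.
have z00 : hy1 p + (0 : R)%:C * hy1 X = hy1 p by rewrite mul0r addr0.
have dV := has_derivM dy (@has_derivV _ _ _ _ _ dz).
rewrite /= y00 z00 gt_eqF // in dV; have {}dV := dV isT.
have dS := has_deriv_comp dV (@is_derive1_sqrt _ _ _).
rewrite /= y00 z00 divr_gt0 // in dS; have {}dS := dS isT.
have dE := has_deriv_comp dx (@is_derive1_sqrt _ _ _).
rewrite /= x00 qx in dE; have {}dE := dE isT.
have dR := has_derivM dS (has_derivX k dE).
rewrite /= x00 y00 z00 in dR.
apply: has_deriv_ext; last first.
  apply: has_deriv_eq dR _.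
  rewrite -[X in rad k X](hpt_eta p) rad_hpt /log_form.
  set e := Num.sqrt (hsq _); set s := Num.sqrt (_ / _).
  have e0 : e != 0 by rewrite gt_eqF // sqrtr_gt0.
  have s0 : s != 0 by rewrite gt_eqF // sqrtr_gt0 divr_gt0.
  have s2 : s ^+ 2 = sqnorm (hy0 p) / sqnorm (hy1 p).
    by rewrite sqr_sqrtr // ltW // divr_gt0.
  have e2 : e ^+ 2 = hsq (hx p) by rewrite sqr_sqrtr // ltW.
  rewrite ReD ReD (_ : complex.Re (- _) = - complex.Re (hy1 X / hy1 p)); last first.
    by case: (_ / _).
  have -> : complex.Re (k%:R * hdot (hx X) (hx p) / (hsq (hx p))%:C) =
      k%:R * complex.Re (hdot (hx X) (hx p)) / hsq (hx p).
    have -> : k%:R * hdot (hx X) (hx p) / (hsq (hx p))%:C =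
       (k%:R / hsq (hx p))%:C * hdot (hx X) (hx p).
      by rewrite rmorphM fmorphV rmorph_nat /= mulrAC.
    by rewrite ReMr mulrAC.
  rewrite !Re_div -e2.
  have -> : k%:R * e ^+ k.-1 = k%:R * e ^+ k / e.
    by case: (k) => [|j]; rewrite ?mul0r // exprS; field.
  have -> : sqnorm (hy0 p) = s ^+ 2 * sqnorm (hy1 p) by rewrite s2 divfK // gt_eqF.
  by field; rewrite e0 s0 gt_eqF.
by move=> t; rewrite hy_line rad_hpt.
Qed.

End RadialDerivative.

Section GeneratingForm.
Variables (R : realType) (n k : nat).
Implicit Types (p X : 'rV[R[i]]_(n + 2)).

Lemma log_form_i p X : log_form k p ('i%C *: X) = 'i%C * log_form k p X.
Proof.
rewrite -(hpt_eta X) hptZ /log_form !hptE hdotZl.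
by rewrite mulrDr mulrBr !mulrA (mulrC k%:R).
Qed.

(** Since dU = phi(U) d log r, one has dt = sqrt(phi) Re eta with eta = [log_form]. Passing from X
    to i X replaces Re eta by - Im eta, and the squares add up to phi |eta|^2. *)
Lemma dt_form_sqr (phi U : R -> R) p X : homog_star p ->
  0 < phi (U (rad k p)) ->
  has_deriv U (rad k p) (phi (U (rad k p)) / rad k p) ->
  dt_form k phi U p X ^+ 2 + dt_form k phi U p ('i%C *: X) ^+ 2 =
  phi (U (rad k p)) * sqnorm (log_form k p X).
Proof.
move=> hp ph hU; have r0 : rad k p != 0 by rewrite gt_eqF // rad_gt0.
have key Y : dt_form k phi U p Y =
    Num.sqrt (phi (U (rad k p))) * complex.Re (log_form k p Y).
  rewrite /dt_form /rderive.
  have hU' : has_deriv U (rad k (p + (0 : R)%:C *: Y)) (phi (U (rad k p)) / rad k p).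
    by rewrite scale0r addr0.
  rewrite (has_deriv_derive1 (has_deriv_comp (has_deriv_rad k Y hp) hU')).
  rewrite -{1}[phi (U _)]sqr_sqrtr ?ltW //; field.
  by rewrite r0 gt_eqF // sqrtr_gt0.
rewrite !key !exprMn sqr_sqrtr ?ltW // -mulrDr log_form_i.
congr (_ * _); rewrite ReM /sqnorm /=; ring.
Qed.

Lemma fubini_study_fs p X : hx p != 0 ->
  (fubini_study (hx p) (hx X))%:C = 2 * n%:R * fs_form p X X.
Proof.
move=> x0; have q0 : hsq (hx p) != 0 by rewrite hsq_eq0.
have en x : enorm x ^+ 2 = hsq x :> R by rewrite enorm_sqrt sqr_sqrtr // hsq_ge0.
rewrite /fubini_study -/(hdot _ _) normc_sqnorm sqr_sqrtr ?sqnorm_ge0 //.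
rewrite (exprM _ 2 2) !en !(rmorphM, rmorphB, fmorphV, rmorph_nat) /=.
rewrite sqnormE /fs_form hdotxx (hdotC (hx X) (hx p)) !(rmorphM, rmorphXn) /=.
by [].
Qed.

End GeneratingForm.

(** * Scaling of metrics *)

Section Scaling.
Variable R : realType.

(** Where f is not differentiable, both sides take the default value 0. Being unconditional, the
    identity passes to iterated derivatives as an equality of functions, also outside the domain of
    smoothness. *)
Lemma derive1Z (f : R -> R) (c x : R) : c != 0 ->
  derive1 (fun t => c * f t) x = c * derive1 f x.
Proof.
move=> c0; have [df|ndf] := pselect (derivable f x 1).
  apply: has_deriv_derive1; apply: has_deriv_eq.
    exact: has_derivM (has_deriv_cst x c) (derivable_has_deriv df).
  by rewrite mul0r add0r.
have ndcf : ~ derivable (fun t => c * f t) x 1.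
  move=> dcf; apply: ndf.
  have [] := has_derivM (has_deriv_cst x c^-1) (derivable_has_deriv dcf).
  suff -> : (fun t => c^-1 * (c * f t)) = f by [].
  by apply/funext => t; rewrite mulKf.
have dvg (g : R -> R) : ~ derivable g x 1 -> derive1 g x = 0.
  move=> ng; rewrite derive1E; have := dvgP ng.
  by rewrite -/(derive g x 1) => ->; exact: erefl.
by rewrite !dvg // mulr0.
Qed.

Variable m : nat.
Implicit Types (f : 'rV[R[i]]_m -> R[i]) (v p : 'rV[R[i]]_m).

Lemma cderiveZ (c : R) v f p : c != 0 ->
  cderive v (fun q => c%:C * f q) p = c%:C * cderive v f p.
Proof.
move=> c0; rewrite /cderive /rderive.
have -> : (fun t : R => complex.Re (c%:C * f (p + t%:C *: v))) =
  (fun t => c * complex.Re (f (p + t%:C *: v))) by apply/funext => t; rewrite ReMr.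
have -> : (fun t : R => complex.Im (c%:C * f (p + t%:C *: v))) =
  (fun t => c * complex.Im (f (p + t%:C *: v))) by apply/funext => t; rewrite ImMr.
rewrite !derive1Z //; apply/eqP; rewrite eq_complex /=.
by apply/andP; split; apply/eqP; ring.
Qed.

Lemma dzZ (c : R) a f p : c != 0 ->
  dz a (fun q => c%:C * f q) p = c%:C * dz a f p.
Proof.
move=> c0; rewrite /dz (cderiveZ (delta_mx 0 a) f p c0).
rewrite (cderiveZ ('i%C *: delta_mx 0 a) f p c0).
move: (cderive _ f p) (cderive _ f p) => u w.
by rewrite ['i%C * _]mulrCA -mulrBr mulrA.
Qed.

Lemma foldr_cderiveZ (c : R) f vs : c != 0 ->
  foldr (@cderive R m) (fun q => c%:C * f q) vs =
  fun q => c%:C * foldr (@cderive R m) f vs q.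
Proof.
move=> c0; elim: vs => //= v vs ->; by apply/funext => p; rewrite (cderiveZ v _ p c0).
Qed.

Lemma smooth_onZ (c : R) D f : c != 0 -> smooth_on D f ->
  smooth_on D (fun q => c%:C * f q).
Proof.
move=> c0 hf vs p Dp; rewrite foldr_cderiveZ //=.
have [hc hd] := hf vs p Dp; split.
  exact: (@cvgMl_tmp _ _ _ _ _ c%:C _ hc).
move=> v; have [hr hi] := hd v.
have [d1 _] := has_derivM (has_deriv_cst 0 c) (derivable_has_deriv hr).
have [d2 _] := has_derivM (has_deriv_cst 0 c) (derivable_has_deriv hi).
split; rewrite /rderivable.
  rewrite (_ : (fun t : R => _) =
    (fun t : R => c * complex.Re (foldr (@cderive R m) f vs (p + t%:C *: v)))) //.
  by apply/funext => t; exact: ReMr.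
rewrite (_ : (fun t : R => _) =
  (fun t : R => c * complex.Im (foldr (@cderive R m) f vs (p + t%:C *: v)))) //.
by apply/funext => t; exact: ImMr.
Qed.

End Scaling.

Lemma unitary_kahler_metricZ (R : realType) n k (c : R)
    (G : 'rV[R[i]]_(n + 2) -> 'M[R[i]]_(n + 2)) :
  0 < c -> unitary_kahler_metric k G ->
  unitary_kahler_metric k (fun p => c%:C *: G p).
Proof.
move=> c0 [[sG hG pG nG tG cG] uG]; have cn0 : c != 0 by rewrite gt_eqF.
have cC : c%:C != 0 :> R[i] by rewrite realC_neq0 cn0.
have scale_inv T : invariant_under T G -> invariant_under T (fun p => c%:C *: G p).
  by move=> h p hp; rewrite -scalemxAr -scalemxAl h.
split; last by move=> u hu; apply: scale_inv; exact: uG.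
split.
- move=> a b.
  have -> : (fun p => (c%:C *: G p) a b) = (fun p => c%:C * G p a b).
    by apply/funext => p; rewrite mxE.
  exact: smooth_onZ.
- move=> p hp; rewrite linearZ /= map_mxZ hG //; congr (_ *: _).
  exact: conjc_real.
- by move=> p X hp; rewrite sform_scale mulr_ge0 ?pG // ler0c ltW.
- move=> p X hp; rewrite sform_scale -nG //; split => [/eqP|->]; last by rewrite mulr0.
  by rewrite mulf_eq0 (negbTE cC) => /eqP.
- by move=> lam mu l0 m0; apply: scale_inv; exact: tG.
- move=> p a b d hp.
  have e a' b' : (fun q => (c%:C *: G q) a' b') = (fun q => c%:C * G q a' b').
    by apply/funext => q; rewrite mxE.
  rewrite !e (dzZ d (fun q => G q a b) p cn0) (dzZ a (fun q => G q d b) p cn0).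
  by rewrite cG.
Qed.

(** * The metric in the holomorphic charts *)

Section Charts.
Variables (R : realType) (n k : nat) (i : 'I_n) (j : 'I_2).
Implicit Types (p v : 'rV[R[i]]_n).

Definition chart_base p : 'rV[R[i]]_n := \row_l if l == i then 1 else p 0 l.

Lemma mul_chart_lin v : v *m chart_lin R i j =
  hpt (\row_l if l == i then 0 else v 0 l)
    (if j == 0 then v 0 i else 0) (if j == 0 then 0 else v 0 i).
Proof.
rewrite /chart_lin mul_mx_row /hpt; congr row_mx; apply/rowP => l; rewrite !mxE.
  have [->|li] := eqVneq l i.
    by rewrite big1 // => a _; rewrite mxE eqxx andbF mulr0.
  rewrite (bigD1 l) //= mxE eqxx li mulr1 big1 ?addr0 // => a al.
  by rewrite mxE (negbTE al) mulr0.
rewrite (bigD1 i) //= mxE eqxx big1 ?addr0 => [|a ai]; last first.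
  by rewrite mxE (negbTE ai) mulr0.
case: l => [[|[|//]] hl]; case: (j) => [[|[|//]] hj];
  by rewrite -!(inj_eq val_inj) /= ?mulr1 ?mulr0.
Qed.

Lemma chartE p : chart i j p =
  hpt (chart_base p) (if j == 0 then p 0 i else 1) (if j == 0 then 1 else p 0 i).
Proof.
rewrite /chart mul_chart_lin /hpt add_row_mx.
congr row_mx; apply/rowP => l; rewrite !mxE.
  by case: eqP; rewrite /= ?add0r ?addr0.
case: l => [[|[|//]] hl]; case: (j) => [[|[|//]] hj];
  by rewrite -!(inj_eq val_inj) /= ?addr0 ?add0r.
Qed.

Lemma chart_line p v (t : R[i]) :
  chart i j (p + t *: v) = chart i j p + t *: (v *m chart_lin R i j).
Proof. by rewrite /chart mulmxDl -scalemxAl addrAC. Qed.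

Lemma delta_chart_lin b : b != i ->
  delta_mx 0 b *m chart_lin R i j = hpt (delta_mx 0 b) 0 0.
Proof.
move=> bi; rewrite mul_chart_lin !mxE (eq_sym i b) (negbTE bi) andbF !if_same.
congr hpt; apply/rowP => l; rewrite !mxE; case: eqP => // ->.
by rewrite (eq_sym i b) (negbTE bi) andbF.
Qed.

Lemma delta_chart_fiber : delta_mx 0 i *m chart_lin R i j =
  hpt 0 (if j == 0 then 1 else 0) (if j == 0 then 0 else 1).
Proof.
rewrite mul_chart_lin !mxE !eqxx; congr hpt; apply/rowP => l; rewrite !mxE.
by case: eqP => // /eqP/negbTE ->; rewrite andbF.
Qed.

Lemma delta_chart_fiber_mx :
  delta_mx 0 i *m chart_lin R i j = delta_mx 0 (rshift n j) :> 'rV[R[i]]_(n + 2).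
Proof.
rewrite delta_chart_fiber; case: j => [[|[|//]] hj] /=.
  by rewrite -delta_hpt_y0; congr delta_mx; exact: val_inj.
by rewrite -delta_hpt_y1; congr delta_mx; exact: val_inj.
Qed.

Lemma chart_base_neq0 p : chart_base p != 0.
Proof. by apply/eqP => /rowP/(_ i); rewrite !mxE eqxx => /eqP; rewrite oner_eq0. Qed.

Lemma homog_chart p : homog (chart i j p).
Proof.
rewrite chartE; apply: homog_hpt; first exact: chart_base_neq0.
by case: ifP => _; rewrite oner_eq0 ?orbT.
Qed.

Lemma homog_star_chart p : p 0 i != 0 -> homog_star (chart i j p).
Proof.
move=> z0; rewrite chartE.
by apply: homog_star_hpt; rewrite ?chart_base_neq0 //; case: ifP => _; rewrite ?oner_eq0.
Qed.

Lemma chart_base_line p (c : R[i]) :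
  chart_base (p + c *: delta_mx 0 i) = chart_base p.
Proof.
apply/rowP => l; rewrite !mxE; case: eqP => // _.
by rewrite andbF mulr0 addr0.
Qed.

Lemma sqr_rad_chart p : p 0 i != 0 -> rad k (chart i j p) ^+ 2 =
  (if j == 0 then sqnorm (p 0 i) else (sqnorm (p 0 i))^-1) * hsq (chart_base p) ^+ k.
Proof.
move=> z0; rewrite chartE rad_hpt exprMn -exprM mulnC exprM.
rewrite !sqr_sqrtr ?hsq_ge0 ?divr_ge0 ?sqnorm_ge0 //.
by case: ifP => _; rewrite sqnorm1 ?divr1 ?div1r.
Qed.

Variable G : 'rV[R[i]]_(n + 2) -> 'M[R[i]]_(n + 2).
Hypothesis hG : unitary_kahler_metric k G.
Local Notation H := (chart_metric G i j).

Lemma chart_metricE p a b : H p a b = sform (G (chart i j p))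
  (delta_mx 0 a *m chart_lin R i j) (delta_mx 0 b *m chart_lin R i j).
Proof. by rewrite -sform_mul -/(chart_metric G i j p) sform_delta. Qed.

(** The charts are transverse to the orbits: a kernel vector is an orbit direction, the constant
    coordinate x_i = 1 forces a = 0, the constant y-coordinate forces b = 0, and the vector
    vanishes. *)
Lemma chart_metric_unit p : H p \in unitmx.
Proof.
rewrite -row_free_unit; apply: inj_row_free => v hv.
have : sform (H p) v v = 0 by rewrite /sform hv mul0mx mxE.
rewrite sform_mul => /(kahler_null hG.1 _ (homog_chart p)) [a [b]].
rewrite mul_chart_lin chartE !hptE => e.
have ex := congr1 (@hx R n) e.
have e0 := congr1 (@hy0 R n) e; have e1 := congr1 (@hy1 R n) e.
rewrite -/(hpt _ _ _) in ex e0 e1; rewrite !hptE in ex e0 e1.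
have a0 : a = 0 by have /rowP/(_ i) := ex; rewrite !mxE eqxx mulr1 => <-.
have b0 : b = 0.
  move: e0 e1; rewrite a0 mulr0 subr0; case: ifP => _; rewrite mulr1 => h1 h2.
    by [].
  by [].
apply/rowP => l; rewrite mxE; have [->|li] := eqVneq l i.
  by move: e0 e1; rewrite a0 b0 mulr0 subr0 !mul0r; case: ifP.
by have /rowP/(_ l) := ex; rewrite !mxE (negbTE li) a0 mul0r.
Qed.

Lemma chart_metric_cderivable v p b : exists l, is_cderive v (fun q => H q i b) p l.
Proof.
pose c : 'I_(n + 2) := if b == i then rshift n j else lshift 2 b.
have e q : H q i b = G (chart i j q) (rshift n j) c.
  rewrite chart_metricE delta_chart_fiber_mx /c.
  case: eqP => [->|/eqP bi]; first by rewrite delta_chart_fiber_mx sform_delta.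
  by rewrite delta_chart_lin // -delta_hpt_x sform_delta.
have [_ /(_ (v *m chart_lin R i j))] :=
  kahler_smooth hG.1 (rshift n j) c [::] (homog_chart p).
move=> /cderivable_is /= [hr hi]; eexists; split.
  by apply: has_deriv_ext hr => t; rewrite e chart_line.
by apply: has_deriv_ext hi => t; rewrite e chart_line.
Qed.

(** The number kappa, for b != i: it does not involve the i-th coordinate of p, hence is constant
    along the fiber. The sign reflects that the fiber coordinate is v for j = 0 and 1/v for j =
    1. *)
Definition chart_slope p (b : 'I_n) : R[i] :=
  (if j == 0 then 1 else -1) * (k%:R * p 0 b / (hsq (chart_base p))%:C).

(** Only the [log_form] term survives against the vertical vector, on which [log_form] is 1/z or
    -1/z; writing 1/z as zbar/|z|^2 exposes the common radial factor. *)
Lemma chart_metric_row (i0 i1 : 'I_n) p : (0 < k)%N -> i1 != i0 -> p 0 i != 0 ->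
  let r := rad k (chart i j p) in
  let f := r ^+ 2 * fiber_coeff i0 G r / sqnorm (p 0 i) in
  H p i i = f%:C /\
  forall b, b != i -> H p i b = f%:C * (p 0 i)^*%R * chart_slope p b.
Proof.
move=> k0 i10 z0 r f; have hs := homog_star_chart z0.
have qC : (sqnorm (p 0 i))%:C != 0 :> R[i].
  by rewrite realC_neq0 sqnorm_eq0 z0.
have zc : (p 0 i)^*%R != 0 by rewrite conjC_eq0.
set eps : R[i] := if j == 0 then 1 else -1.
have e2 : eps * eps = 1.
  by rewrite /eps; case: ifP => _; rewrite ?mulr1 // mulrNN mulr1.
have ec : eps^*%R = eps.
  by rewrite /eps; case: ifP => _; rewrite ?conjC1 ?rmorphN1.
have li : log_form k (chart i j p) (delta_mx 0 i *m chart_lin R i j) =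
    eps / p 0 i.
  rewrite delta_chart_fiber chartE /log_form !hptE hdot0l mulr0 mul0r addr0 /eps.
  by case: ifP => _; rewrite ?mul0r ?subr0 ?sub0r ?mulNr.
have fsi Y : fs_form (chart i j p) (delta_mx 0 i *m chart_lin R i j) Y = 0.
  by rewrite delta_chart_fiber /fs_form hx_hpt !hdot0l !mul0r subrr.
have cl : (eps / p 0 i)^*%R = eps / (p 0 i)^*%R by rewrite rmorphM fmorphV /= ec.
have fE : f%:C = (r ^+ 2 * fiber_coeff i0 G r)%:C / (p 0 i * (p 0 i)^*%R).
  by rewrite /f rmorphM fmorphV /= sqnormE.
rewrite fE; split=> [|b bi]; rewrite chart_metricE (metric_structure k0 i10 hG) //;
  rewrite fsi mulr0 add0r li -/r; move: (_ ^+ 2 * _)%:C => F.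
  by rewrite cl mulf_div e2 div1r.
have -> : log_form k (chart i j p) (delta_mx 0 b *m chart_lin R i j) =
    k%:R * (p 0 b)^*%R / (hsq (chart_base p))%:C.
  rewrite delta_chart_lin // chartE /log_form !hptE !mul0r subr0 add0r.
  by rewrite hdotC hdot_delta mxE (negbTE bi).
rewrite !rmorphM fmorphV /= conjCK.
have -> : ((hsq (chart_base p))%:C)^*%R = (hsq (chart_base p))%:C :> R[i].
  exact: conjc_real.
have -> : ((k%:R : R[i])^*)%R = k%:R by exact: conjc_nat.
rewrite /chart_slope -/eps.
have hq : (hsq (chart_base p))%:C != 0 :> R[i].
  by rewrite realC_neq0 hsq_eq0 chart_base_neq0.
move: (hsq _)%:C hq => q hq.
by field; rewrite z0 zc hq.
Qed.

Lemma riem_at_fiber p (z : R[i]) : riem_at H p (z *: delta_mx 0 i) =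
  riem H p i i i i * (sqnorm z ^+ 2)%:C.
Proof.
rewrite /riem_at; set X := z *: _.
have X0 a : a != i -> X 0 a = 0 by move=> ai; rewrite !mxE (negbTE ai) andbF mulr0.
have Xi : X 0 i = z by rewrite !mxE !eqxx mulr1.
rewrite (bigD1 i) //= [X in _ + X]big1 ?addr0 => [|a ai]; last first.
  rewrite big1 // => b _; rewrite big1 // => c _; rewrite big1 // => d _.
  by rewrite X0 // mulr0 !mul0r.
rewrite (bigD1 i) //= [X in _ + X]big1 ?addr0 => [|b bi]; last first.
  rewrite big1 // => c _; rewrite big1 // => d _.
  by rewrite [X 0 b]X0 // conjC0 mulr0 !mul0r.
rewrite (bigD1 i) //= [X in _ + X]big1 ?addr0 => [|c ci]; last first.
  by rewrite big1 // => d _; rewrite [X 0 c]X0 // mulr0 !mul0r.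
rewrite (bigD1 i) //= [X in _ + X]big1 ?addr0 => [|d di]; last first.
  by rewrite [X 0 d]X0 // conjC0 mulr0.
by rewrite Xi rmorphXn /= sqnormE; ring.
Qed.

End Charts.

(** Differentiability along a line serves as continuity: it carries formulas for the metric from L^*
    over to points of E_0 and E_oo. *)
Lemma cderive_unique_limit (R : realType) m (v p : 'rV[R[i]]_m) f g l l' :
  is_cderive v f p l -> is_cderive v g p l' ->
  (forall t : R, t != 0 -> f (p + t%:C *: v) = g (p + t%:C *: v)) -> f p = g p.
Proof.
have key (a b : R -> R) x y : has_deriv a 0 x -> has_deriv b 0 y ->
    (forall t, t != 0 -> a t = b t) -> a 0 = b 0.
  move=> /has_deriv_continuous ha /has_deriv_continuous hb ab.
  have ha' : a t @[t --> (0 : R)^'] --> a 0 by exact: cvg_within_filter ha.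
  have hb' : b t @[t --> (0 : R)^'] --> b 0 by exact: cvg_within_filter hb.
  apply: (cvg_unique _ ha'); first exact: norm_hausdorff.
  apply: cvg_trans hb'; apply: near_eq_cvg; near=> t.
  by rewrite ab //; near: t; exact: nbhs_dnbhs_neq.
move=> [fr fi] [gr gi] fg.
have /= hr := key _ _ _ _ fr gr (fun t t0 => congr1 (@complex.Re R) (fg t t0)).
have /= hi := key _ _ _ _ fi gi (fun t t0 => congr1 (@complex.Im R) (fg t t0)).
by move: hr hi; rewrite !line0; case: (f p) (g p) => a b [c d] /= -> ->.
Unshelve. all: by end_near. Qed.

(** * Hitchin's examples have constant A *)

Section HitchinConstantCurvature.
Variable R : realType.

Lemma has_deriv0_pos (f : R -> R) : (forall x, 0 < x -> has_deriv f x 0) ->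
  forall x, 0 < x -> f x = f 1.
Proof.
move=> fd; have key a b : 0 < a -> a < b -> f b = f a.
  move=> a0 ab.
  have := @derive0_eq0 R (fun t => f (a + t)) _ _ (b - a).
  rewrite addr0 addrCA subrr addr0; apply; last by rewrite subr_gt0.
    have /has_deriv_shift/has_deriv_continuous := fd a a0.
    by rewrite addr0.
  move=> t t0; apply/(has_deriv_shift t (fun t => f (a + t)) 0).
  have /has_deriv_shift := fd (a + t) (addr_gt0 a0 t0).
  by apply: has_deriv_ext => u; rewrite addrA.
move=> x x0; have [x1|x1|->//] := ltgtP x 1; last exact: key.
by rewrite (key x 1).
Qed.

Lemma hitchin_phiE n (s u : R) : n%:R * s != 0 ->
  hitchin_phi n s u = 2 * u * (n%:R * s - u) / (n%:R * s).
Proof.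
rewrite mulf_eq0 negb_or => /andP[n0 s0].
by rewrite /hitchin_phi; field; rewrite n0 s0.
Qed.

(** Separation of variables: U / ((N - U) r^2) is conserved, and [kap] is its value at r = 1. *)
Lemma logistic_solution (N : R) (U : R -> R) : 0 < N ->
  (forall r, 0 < r -> 0 < U r < N) ->
  (forall r, 0 < r -> has_deriv U r (2 * U r * (N - U r) / N / r)) ->
  exists2 kap, 0 < kap &
    forall r, 0 < r -> U r = N * (kap * r ^+ 2) / (1 + kap * r ^+ 2).
Proof.
move=> N0 Ub Ud; pose y r := U r / (N - U r) / r ^+ 2.
have yc r : 0 < r -> y r = y 1.
  apply: has_deriv0_pos => {}r r0; have /andP[U0 U1] := Ub r r0.
  have NU : N - U r != 0 by rewrite gt_eqF // subr_gt0.
  apply: has_deriv_eq.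
    apply: has_derivM.
      apply: has_derivM (Ud r r0)
        (has_derivV _ (has_derivB (has_deriv_cst r N) (Ud r r0))).
      exact: NU.
    apply: has_derivV (has_derivX 2 (has_deriv_id r)).
    by rewrite expf_neq0 // gt_eqF.
  by rewrite /=; field; rewrite NU !gt_eqF.
exists (y 1).
  have /andP[U0 U1] := Ub 1 ltr01.
  by rewrite /y expr1n divr1 divr_gt0 // subr_gt0.
move=> r r0; rewrite -(yc r r0) /y; have /andP[U0 U1] := Ub r r0.
have NU : N - U r != 0 by rewrite gt_eqF // subr_gt0.
by field; rewrite subrK NU !gt_eqF.
Qed.

Lemma has_deriv_inv_square (C K s : R) : 1 + K * s != 0 ->
  has_deriv (fun s => C / (1 + K * s) ^+ 2) s (- 2 * C * K / (1 + K * s) ^+ 3).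
Proof.
move=> h; apply: has_deriv_eq.
  apply: has_derivM (has_deriv_cst s C) (has_derivV _ (has_derivX 2 _)); last first.
    apply: has_deriv_ext (has_deriv_affine s 1 K) => t; by rewrite mulrC.
  by rewrite expf_neq0.
by rewrite /=; field.
Qed.

Lemma has_deriv_inv_cube (C K s : R) : 1 + K * s != 0 ->
  has_deriv (fun s => - 2 * C * K / (1 + K * s) ^+ 3) s
    (6 * C * K ^+ 2 / (1 + K * s) ^+ 4).
Proof.
move=> h; apply: has_deriv_eq.
  apply: has_derivM (has_deriv_cst s (- 2 * C * K))
    (has_derivV _ (has_derivX 3 _)); last first.
    apply: has_deriv_ext (has_deriv_affine s 1 K) => t; by rewrite mulrC.
  by rewrite expf_neq0.
by rewrite /=; field.
Qed.

Variables (n k : nat) (i0 i1 : 'I_n).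
Hypotheses (k_gt0 : (0 < k)%N) (i10 : i1 != i0).
Variable G : 'rV[R[i]]_(n + 2) -> 'M[R[i]]_(n + 2).
Hypothesis hG : unitary_kahler_metric k G.

(** The vertical vector isolates the coefficient: the Fubini-Study term vanishes on it and
    [log_form] equals 1/r. *)
Lemma generating_function_fiber_coeff (phi U : R -> R) (c r : R) :
  0 < r -> 0 < phi (U r) -> has_deriv U r (phi (U r) / r) ->
  2 * sform (c%:C *: G (base_pt i0 r)) (hpt 0 1 0) (hpt 0 1 0) =
    ((1 + k%:R / n%:R * U (rad k (base_pt i0 r)))
       * fubini_study (hx (base_pt i0 r)) (hx (hpt 0 1 0))
     + dt_form k phi U (base_pt i0 r) (hpt 0 1 0) ^+ 2
     + dt_form k phi U (base_pt i0 r) ('i%C *: hpt 0 1 0) ^+ 2)%:C ->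
  2 * c * (r ^+ 2 * fiber_coeff i0 G r) = phi (U r).
Proof.
move=> r0 ph hU; have hr := rad_base_pt k i0 r0.
have rn : r != 0 by rewrite gt_eqF.
have hs : homog_star (base_pt i0 r).
  apply: homog_star_hpt; rewrite ?delta_neq0 ?oner_neq0 //.
  by rewrite realC_neq0 rn.
have h1 : 0 < phi (U (rad k (base_pt i0 r))) by rewrite hr.
have h2 : has_deriv U (rad k (base_pt i0 r))
    (phi (U (rad k (base_pt i0 r))) / rad k (base_pt i0 r)) by rewrite hr.
rewrite -addrA (dt_form_sqr _ hs h1 h2) hr.
rewrite sform_scale (metric_structure k_gt0 i10 hG) // hr.
have -> : fs_form (base_pt i0 r) (hpt 0 1 0) (hpt 0 1 0) = 0.
  by rewrite /fs_form hx_hpt !hdot0l !mul0r subrr.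
have -> : fubini_study (hx (base_pt i0 r)) (hx (hpt 0 1 0)) = 0 :> R.
  apply: (@complexI R); rewrite fubini_study_fs; last by case: hs.
  by rewrite /fs_form hx_hpt !hdot0l !mul0r subrr mulr0.
have -> : log_form k (base_pt i0 r) (hpt 0 1 0) = (r^-1)%:C.
  rewrite /log_form /base_pt !hptE hdot0l mul0r subr0 mulr0 mul0r addr0.
  by rewrite div1r fmorphV.
rewrite !mulr0 !add0r sqnorm_real -sqnormE sqnorm_real.
move=> /(congr1 (@complex.Re R)).
have -> : 2 * (c%:C * ((r ^+ 2 * fiber_coeff i0 G r)%:C * (r^-1 ^+ 2)%:C))
   = (2 * (c * (r ^+ 2 * fiber_coeff i0 G r * r^-1 ^+ 2)))%:C.
  by rewrite !rmorphM rmorph_nat.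
move=> /= e.
have <- : phi (U r) * r^-1 ^+ 2 * r ^+ 2 = phi (U r) by field.
by rewrite -e; field.
Qed.

Lemma hitchin_constant_A (c s : R) : 0 < c -> 0 < s ->
  has_generating_function k (hitchin_phi n s) 0 (n%:R * s)
    (fun p => c%:C *: G p) ->
  constant_A G.
Proof.
move=> c0 s0 [U [hU _ _ hform]].
have n0 : (0 < n)%N by case: (n) i0 => // -[].
set N := n%:R * s.
have N0 : 0 < N by rewrite mulr_gt0 // ltr0n.
have cn : c != 0 by rewrite gt_eqF.
have Nn : N != 0 by rewrite gt_eqF.
have Ub r : 0 < r -> 0 < U r < N by move=> r0; have [] := hU r r0.
have phiE r : hitchin_phi n s (U r) = 2 * U r * (N - U r) / N.
  exact: hitchin_phiE.
have Ud r : 0 < r -> has_deriv U r (hitchin_phi n s (U r) / r).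
  move=> r0; have [_ dU e] := hU r r0.
  have := derivable_has_deriv dU; congr has_deriv; rewrite -e.
  by field; rewrite gt_eqF.
have Ud' r : 0 < r -> has_deriv U r (2 * U r * (N - U r) / N / r).
  by move=> r0; rewrite -phiE; exact: Ud.
have [kap kap0 UE] := logistic_solution N0 Ub Ud'.
have fc r : 0 < r -> r ^+ 2 * fiber_coeff i0 G r =
    N / c * (kap * r ^+ 2) / (1 + kap * r ^+ 2) ^+ 2.
  move=> r0; have /andP[U0 U1] := Ub r r0.
  have ph : 0 < hitchin_phi n s (U r).
    by rewrite phiE divr_gt0 // !mulr_gt0 // subr_gt0.
  have hs : homog_star (base_pt i0 r).
    apply: homog_star_hpt; rewrite ?delta_neq0 ?oner_neq0 //.
    by rewrite realC_neq0 gt_eqF.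
  have := generating_function_fiber_coeff r0 ph (Ud r r0) (hform _ (hpt 0 1 0) hs).
  rewrite phiE UE // => e.
  have d0 : 1 + kap * r ^+ 2 != 0.
    by rewrite gt_eqF // addr_gt0 // mulr_gt0 // exprn_gt0.
  have -> : r ^+ 2 * fiber_coeff i0 G r =
    2 * c * (r ^+ 2 * fiber_coeff i0 G r) / (2 * c) by field.
  by rewrite e; field; rewrite cn Nn d0.
(* This is 2K/C for the K and C below: in the quotient the dependence on the fiber cancels. *)
exists (2 * c / N) => i j p e0 [z ->].
(* With x = [chart_base i p], one has r^2 = |z|^2 |x|^(2k) for j = 0 and r^2 = |x|^(2k) / |z|^2 for
   j = 1. As u / (1 + u)^2 is invariant under u -> 1/u, Phi has the same shape in both charts, with
   K inverted. *)
pose K := if j == 0 then kap * hsq (chart_base i p) ^+ k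
          else (kap * hsq (chart_base i p) ^+ k)^-1.
have M0 : 0 < kap * hsq (chart_base i p) ^+ k.
  by rewrite mulr_gt0 // exprn_gt0 // hsq_gt0 chart_base_neq0.
have K0 : 0 < K by rewrite /K; case: ifP => _; rewrite ?invr_gt0.
pose C := N * K / c.
have C0 : 0 < C by rewrite divr_gt0 // mulr_gt0.
pose phi t := C / (1 + K * t) ^+ 2.
have pos t : - K^-1 < t -> 1 + K * t != 0.
  move=> ht; rewrite gt_eqF //.
  have : 0 < K * (t + K^-1) by rewrite mulr_gt0 // -(opprK K^-1) subr_gt0.
  by rewrite mulrDr divff ?gt_eqF // addrC.
have row1 (a : R[i]) : let q := p + a *: delta_mx 0 i in q 0 i != 0 ->
    chart_metric G i j q i i = (phi (sqnorm (q 0 i)))%:C /\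
    forall b, b != i -> chart_metric G i j q i b =
      (phi (sqnorm (q 0 i)))%:C * (q 0 i)^*%R * chart_slope k i j p b.
  move=> q q0; have [hii hib] := chart_metric_row j hG k_gt0 i10 q0.
  have q00 : sqnorm (q 0 i) != 0 by rewrite sqnorm_eq0.
  have qp : 0 < sqnorm (q 0 i) by rewrite sqnorm_gt0.
  have bq : chart_base i q = chart_base i p by exact: chart_base_line.
  have rp := rad_gt0 k (homog_star_chart j q0).
  have e : rad k (chart i j q) ^+ 2 * fiber_coeff i0 G (rad k (chart i j q))
      / sqnorm (q 0 i) = phi (sqnorm (q 0 i)).
    rewrite fc // sqr_rad_chart // bq /phi /C /K.
    move: (hsq _ ^+ k) M0 => M M0; have Mn : M != 0.
      by apply: contraTneq M0 => ->; rewrite mulr0 ltxx.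
    have kn : kap != 0 by rewrite gt_eqF.
    have d0 : 1 + kap * M * sqnorm (q 0 i) != 0.
      by rewrite gt_eqF // addr_gt0 // mulr_gt0.
    have d1 : sqnorm (q 0 i) + kap * M != 0 by rewrite gt_eqF // addr_gt0.
    by case: ifP => _; field; rewrite ?q00 ?cn ?Nn ?Mn ?kn /= andbT // addrC.
  rewrite e in hii hib; split=> // b bi; rewrite hib //; congr (_ * _ * _).
  rewrite /chart_slope bq; congr (_ * (_ * _ / _)).
  by rewrite !mxE (negbTE bi) andbF mulr0 addr0.
(* At z = 0, on E_0 or E_oo, both sides are differentiable along e_i and agree for z != 0, so they
   agree there too. *)
have row (a : R[i]) : let q := p + a *: delta_mx 0 i in
    chart_metric G i j q i i = (phi (sqnorm (q 0 i)))%:C /\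
    forall b, b != i -> chart_metric G i j q i b =
      (phi (sqnorm (q 0 i)))%:C * (q 0 i)^*%R * chart_slope k i j p b.
  move=> q; have [q0|] := eqVneq (q 0 i) 0; last exact: row1.
  have line t : t != 0 -> (q + t%:C *: delta_mx 0 i) 0 i != 0.
    by move=> t0; rewrite mxE q0 add0r !mxE !eqxx mulr1 realC_neq0 t0.
  have line1 t := row1 (a + t%:C); rewrite /= in line1.
  have d0 : has_deriv phi (sqnorm (q 0 i))
      (- 2 * C * K / (1 + K * sqnorm (q 0 i)) ^+ 3).
    apply: has_deriv_inv_square; rewrite q0 sqnorm0 mulr0 addr0.
    exact: oner_neq0.
  have w := is_cderive_radial (delta_mx 0 i) d0.
  have wc := is_cderive_conj (is_cderive_coord (delta_mx 0 i) q i).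
  split=> [|b bi].
    have [l hl] := chart_metric_cderivable i j hG (delta_mx 0 i) q i.
    apply: (cderive_unique_limit hl w) => t t0.
    by have := line t t0; rewrite /q -addrA -scalerDl => /line1[].
  have [l hl] := chart_metric_cderivable i j hG (delta_mx 0 i) q b.
  have w' := is_cderiveM (is_cderiveM w wc)
    (is_cderive_cst (delta_mx 0 i) q (chart_slope k i j p b)).
  apply: (cderive_unique_limit hl w') => t t0.
  by have := line t t0; rewrite /q -addrA -scalerDl => /line1[_ /(_ b bi)].
have p0 : p = p + 0 *: delta_mx 0 i by rewrite scale0r addr0.
have Kp : - K^-1 < sqnorm (p 0 i).
  by apply: lt_le_trans (sqnorm_ge0 _); rewrite oppr_lt0 invr_gt0.
have phip : phi (sqnorm (p 0 i)) != 0.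
  by rewrite /phi mulf_neq0 ?(gt_eqF C0) // invr_eq0 expf_neq0 // pos.
have [hii _] := row 0; rewrite /= -p0 in hii.
rewrite sformZl sformZr sform_delta hii mulrA -sqnormE -rmorphM.
move=> /(congr1 (@complex.Re R)) /= e.
rewrite riem_at_fiber (riem_radial (chart_metric_unit i j hG p) Kp phip
  (fun t ht => has_deriv_inv_square C (pos t ht))
  (fun t ht => has_deriv_inv_cube C (pos t ht)) (fun a _ => row a)).
rewrite -rmorphM /=; congr (_%:C).
have h0 := pos _ Kp.
have -> : sqnorm z = (1 + K * sqnorm (p 0 i)) ^+ 2 / C.
  by apply: (mulIf phip); rewrite e /phi; field; rewrite h0 gt_eqF.
by rewrite /phi /C; field; rewrite h0 cn Nn gt_eqF.
Qed.

End HitchinConstantCurvature.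

(** * Constancy of A forces Hitchin's equation *)

Section ConstantCurvatureODE.
Variable R : realType.

Lemma has_deriv_lt (f df : R -> R) (a b : R) : a < b ->
  (forall x, exists l, has_deriv f x l) ->
  (forall x, a < x < b -> has_deriv f x (df x)) ->
  (forall x, a < x < b -> 0 < df x) -> f a < f b.
Proof.
move=> ab fl fd df0.
have [||x] := @MVT R f df a b ab.
- by move=> x; rewrite in_itv /= => xab; exact: fd.
- apply: continuous_subspaceT => x.
  by have [l hl] := fl x; exact: has_deriv_continuous hl.
rewrite in_itv /= => xab e.
by rewrite -subr_gt0 e mulr_gt0 ?df0 // subr_gt0.
Qed.

Lemma cvg_inv_pinfty (F : R -> R) : F t @[t --> (0 : R)] --> F 0 ->
  F r^-1 @[r --> +oo] --> F 0.
Proof.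
move=> hF; apply: (@cvg_comp _ _ _ (fun r : R => r^-1) F) hF.
have h : (fun r : R => r) r @[r --> +oo] --> +oo by exact: cvg_id.
by apply/(gtr0_cvgV0 _).2 : h; exact: nbhs_pinfty_gt.
Qed.

Variables (n k : nat) (i0 i1 : 'I_n).
Hypotheses (k_gt0 : (0 < k)%N) (i10 : i1 != i0).
Variable G : 'rV[R[i]]_(n + 2) -> 'M[R[i]]_(n + 2).
Hypothesis hG : unitary_kahler_metric k G.

Local Notation a_ := (base_coeff i0 i1 G).
Local Notation h_ := (fiber_coeff i0 G).
Local Notation bp := (base_pt i0).

Let kR : 0 < k%:R :> R. Proof. by rewrite ltr0n. Qed.

Lemma metric_gt0 p X : homog p -> ~ orbit_tangent k p X ->
  0 < complex.Re (sform (G p) X X).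
Proof.
move=> hp hX; have := kahler_ge0 hG.1 X hp.
rewrite (metric_real hG) // ler0c le_eqVlt => /orP[/eqP e|//].
by case: hX; apply/(kahler_null hG.1) => //; rewrite (metric_real hG) // -e.
Qed.

Lemma fiber_coeff_gt0 r : 0 < h_ r.
Proof.
apply: metric_gt0 => [|[a [b]]]; first exact: homog_base_pt.
rewrite -/(hpt _ _ _) /base_pt !hptE => e.
have := congr1 (@hx R n) e; have := congr1 (@hy0 R n) e.
have := congr1 (@hy1 R n) e.
rewrite !hptE mulr1 => <- e0 /rowP/(_ i0); rewrite !mxE !eqxx mulr1 => a0.
by move/eqP: e0; rewrite -a0 mulr0 subr0 mul0r oner_eq0.
Qed.

Lemma base_coeff_gt0 r : 0 < a_ r.
Proof.
apply: metric_gt0 => [|[a [b]]]; first exact: homog_base_pt.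
rewrite -/(hpt _ _ _) /base_pt !hptE => /(congr1 (@hx R n)); rewrite !hptE.
move=> /rowP/(_ i1); rewrite !mxE !eqxx (negbTE i10) mulr0 => /eqP.
by rewrite oner_eq0.
Qed.

(** The points (e_{i0}; 1, 1/r) and (e_{i0}; r, 1) have the same norm, so [metric_structure]
    involves the same a and h at both; the factor r^-2 compensates the value - r of [log_form] on
    the y_1 direction. *)
Lemma infinity_coeff r : 0 < r ->
  a_ r = complex.Re
    (G (hpt (delta_mx 0 i0) 1 (r^-1)%:C) (lshift 2 i1) (lshift 2 i1)) /\
  r ^+ 2 * h_ r = r^-1 ^+ 2 *
    complex.Re (G (hpt (delta_mx 0 i0) 1 (r^-1)%:C) (rshift n 1) (rshift n 1)).
Proof.
move=> r0; set q := hpt _ _ _.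
have rC : (r^-1)%:C != 0 :> R[i] by rewrite realC_neq0 invr_eq0 gt_eqF.
have hs : homog_star q.
  by apply: homog_star_hpt; rewrite ?delta_neq0 ?oner_neq0.
have rq : rad k q = r.
  rewrite rad_hpt hsq_delta sqrtr1 expr1n mulr1 sqnorm1 sqnorm_real div1r exprVn invrK.
  by rewrite sqrtr_sqr ger0_norm // ltW.
split.
  rewrite -sform_delta delta_hpt_x (metric_structure k_gt0 i10 hG) // rq.
  rewrite /log_form /fs_form /q !hptE hsq_delta !mul0r subr0 add0r.
  rewrite hdotxx hsq_delta !hdot_delta !mxE (eq_sym i0) (negbTE i10) andbF.
  by rewrite expr1n rmorph1 /= !(mulr0, mul0r, subr0, divr1, mulr1, addr0).
rewrite -sform_delta delta_hpt_y1 (metric_structure k_gt0 i10 hG) // rq.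
rewrite /log_form /fs_form /q !hptE hsq_delta !hdot0l !mul0r subrr mulr0 add0r.
rewrite mulr0 mul0r addr0 sub0r div1r -fmorphV invrK rmorphN mulrNN /=.
by field; exact: lt0r_neq0.
Qed.

(** The Liouville equation on the fiber over [e_{i0}] at z = r, where Phi(s) = h(sqrt s) and Phi' +
    s Phi'' becomes (h'' + h'/r) / 4. The slopes vanish there, the other chart coordinates being
    0. *)
Lemma constant_A_ode (A : R) (h1 h2 : R -> R) :
  (forall r, has_deriv h_ r (h1 r)) -> (forall r, has_deriv h1 r (h2 r)) ->
  (forall p e0 : 'rV[R[i]]_n, (exists z : R[i], e0 = z *: delta_mx 0 i0) ->
    sform (chart_metric G i0 0 p) e0 e0 = 1 ->
    riem_at (chart_metric G i0 0) p e0 = A%:C) ->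
  forall r, 0 < r ->
  - (h2 r + h1 r / r) / 4 + h1 r ^+ 2 / (4 * h_ r) = A * h_ r ^+ 2.
Proof.
move=> d1 d2 hA r r0; have rn : r != 0 by rewrite gt_eqF.
pose p : 'rV[R[i]]_n := r%:C *: delta_mx 0 i0.
have pi : p 0 i0 = r%:C by rewrite !mxE !eqxx mulr1.
have pb b : b != i0 -> p 0 b = 0.
  by move=> bi; rewrite !mxE (negbTE bi) andbF mulr0.
have cb : chart_base i0 p = delta_mx 0 i0.
  apply/rowP => l; rewrite mxE [RHS]mxE eqxx /=; have [//|li] := eqVneq l i0.
  exact: pb.
have sp : sqnorm (p 0 i0) = r ^+ 2 by rewrite pi sqnorm_real.
have sr : Num.sqrt (r ^+ 2) = r by rewrite sqrtr_sqr ger0_norm // ltW.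
pose phi t := h_ (Num.sqrt t).
pose phi1 t := h1 (Num.sqrt t) * (2 * Num.sqrt t)^-1.
pose phi2 t := h2 (Num.sqrt t) * (2 * Num.sqrt t)^-1 * (2 * Num.sqrt t)^-1
  + h1 (Num.sqrt t) * (- (2 * Num.sqrt t) ^- 2 * (2 * (2 * Num.sqrt t)^-1)).
have D1 t : 0 < t -> has_deriv phi t (phi1 t).
  by move=> t0; exact: has_deriv_comp (is_derive1_sqrt t0) (d1 _).
have D2 t : 0 < t -> has_deriv phi1 t (phi2 t).
  move=> t0; have q0 : 2 * Num.sqrt t != 0.
    by rewrite gt_eqF // mulr_gt0 // sqrtr_gt0.
  apply: has_deriv_eq.
    apply: has_derivM; first exact: has_deriv_comp (is_derive1_sqrt t0) (d2 _).
    apply: has_derivV; first exact: q0.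
    exact: has_derivM (has_deriv_cst t 2) (is_derive1_sqrt t0).
  by rewrite /phi2 mul0r add0r.
have hrow (c : R[i]) : let q := p + c *: delta_mx 0 i0 in 0 < sqnorm (q 0 i0) ->
    chart_metric G i0 0 q i0 i0 = (phi (sqnorm (q 0 i0)))%:C /\
    forall b, b != i0 -> chart_metric G i0 0 q i0 b =
      (phi (sqnorm (q 0 i0)))%:C * (q 0 i0)^*%R * (fun=> 0) b.
  move=> q q0; have qn : q 0 i0 != 0 by rewrite -sqnorm_gt0.
  have [hii hib] := chart_metric_row 0 hG k_gt0 i10 qn.
  have e2 : rad k (chart i0 0 q) ^+ 2 = sqnorm (q 0 i0).
    by rewrite sqr_rad_chart // chart_base_line cb hsq_delta expr1n mulr1.
  have e : rad k (chart i0 0 q) = Num.sqrt (sqnorm (q 0 i0)).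
    by rewrite -e2 sqrtr_sqr ger0_norm // ltW // rad_gt0 //; exact: homog_star_chart.
  have E : sqnorm (q 0 i0) * h_ (Num.sqrt (sqnorm (q 0 i0))) / sqnorm (q 0 i0)
      = phi (sqnorm (q 0 i0)) by rewrite mulrAC divff ?mul1r // gt_eqF.
  rewrite e2 e E in hii hib.
  split=> // b bi; rewrite hib //; congr (_ * _).
  rewrite /chart_slope mxE pb // !mxE (negbTE bi) andbF mulr0 addr0.
  by rewrite !mulr0 mul0r mulr0.
have p0 : p = p + 0 *: delta_mx 0 i0 by rewrite scale0r addr0.
have sp0 : 0 < sqnorm (p 0 i0) by rewrite sp exprn_gt0.
have hr := fiber_coeff_gt0 r.
have hn : h_ r != 0 by rewrite gt_eqF.
have phin : phi (sqnorm (p 0 i0)) != 0 by rewrite sp /phi sr.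
have := hrow 0; rewrite /= -p0 => /(_ sp0)[hii _].
pose z : R[i] := ((Num.sqrt (h_ r))^-1)%:C.
have zz : sqnorm z = (h_ r)^-1.
  by rewrite sqnorm_real exprVn sqr_sqrtr // ltW.
have := hA p (z *: delta_mx 0 i0) (ex_intro _ z erefl).
rewrite sformZl sformZr sform_delta hii mulrA -sqnormE zz sp /phi sr.
rewrite -rmorphM mulVf //.
move=> /(_ erefl); rewrite riem_at_fiber zz.
rewrite (riem_radial (chart_metric_unit i0 0 hG p) sp0 phin D1 D2 hrow) -rmorphM.
move=> /(congr1 (@complex.Re R)) /=; rewrite sp /phi /phi1 /phi2 sr => <-.
by field; rewrite rn hn.
Qed.

Lemma constant_A_hitchin (A : R) :
  (forall p e0 : 'rV[R[i]]_n, (exists z : R[i], e0 = z *: delta_mx 0 i0) ->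
    sform (chart_metric G i0 0 p) e0 e0 = 1 ->
    riem_at (chart_metric G i0 0) p e0 = A%:C) ->
  exists c s : R, [/\ 0 < c, 0 < s & hitchin_metric k s (fun p => c%:C *: G p)].
Proof.
move=> hA; have [h1 [h2 hh]] := fiber_coeff_smooth i0 hG.
have d1 r : has_deriv h_ r (h1 r) by case: (hh r).
have d2 r : has_deriv h1 r (h2 r) by case: (hh r).
have ode := constant_A_ode d1 d2 hA.
have da r : 0 < r -> has_deriv a_ r (2 * k%:R * r * h_ r).
  exact: base_coeff_ode.
have al := base_coeff_derivable i0 i1 hG.
have h0 r := fiber_coeff_gt0 r.
have hn r : h_ r != 0 by rewrite gt_eqF.
have kn : (k%:R : R) != 0 by rewrite gt_eqF.
pose V r := a_ r - a_ 0.
have dV r : 0 < r -> has_deriv V r (2 * k%:R * r * h_ r).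
  move=> r0; apply: has_deriv_eq.
    exact: has_derivB (da r r0) (has_deriv_cst r (a_ 0)).
  by rewrite subr0.
have Vl r : exists l, has_deriv V r l.
  by have [l hl] := al r; eexists; exact: has_derivB hl (has_deriv_cst r (a_ 0)).
have V0 : V 0 = 0 by rewrite /V subrr.
have Vc : V r @[r --> (0 : R)] --> 0.
  by have [l /has_deriv_continuous] := Vl 0; rewrite V0.
(* The equation reads (r h'/h)' = - 4 A r h = - (2A/k) a', and both r h'/h and V vanish at r = 0. *)
have first_int r : 0 < r -> r * h1 r / (2 * h_ r) = - (A / k%:R) * V r.
  pose Q r := r * h1 r * (2 * h_ r)^-1 + A / k%:R * V r.
  have DQ x l : has_deriv V x l -> has_deriv Q x
     ((1 * h1 x + x * h2 x) * (2 * h_ x)^-1 +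
       x * h1 x * (- (2 * h_ x) ^- 2 * (2 * h1 x)) + A / k%:R * l).
    move=> hl; apply: has_deriv_eq.
      apply: has_derivD.
        apply: has_derivM; first exact: has_derivM (has_deriv_id x) (d2 x).
        apply: has_derivV; last exact: has_derivM (has_deriv_cst x 2) (d1 x).
        by rewrite mulf_neq0 // pnatr_eq0.
      exact: has_derivM (has_deriv_cst x (A / k%:R)) hl.
    by rewrite !mul0r !add0r.
  have Q0 : Q 0 = 0 by rewrite /Q V0 !mul0r mulr0 addr0.
  move=> r0; have : Q r = Q 0.
    apply: derive0_eq0 => //.
      by have [l hl] := Vl 0; exact: has_deriv_continuous (DQ _ _ hl).
    move=> x x0; apply: (has_deriv_eq (DQ _ _ (dV x x0))).
    have xn : x != 0 by rewrite gt_eqF.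
    transitivity (2 * x / h_ x * (A * h_ x ^+ 2 -
       (- (h2 x + h1 x / x) / 4 + h1 x ^+ 2 / (4 * h_ x)))).
      by field; rewrite xn hn kn.
    by rewrite ode // subrr mulr0.
  by rewrite Q0 /Q => /eqP; rewrite addr_eq0 mulNr => /eqP.
(* By the first integral, k (r^2 h)' = 2 k r h (1 + r h'/(2h)) = a' (1 - (A/k) V). *)
have second_int r : 0 < r ->
    k%:R * (r ^+ 2 * h_ r) = V r - A / (2 * k%:R) * V r ^+ 2.
  pose W r := k%:R * (r ^+ 2 * h_ r) - V r + A / (2 * k%:R) * V r ^+ 2.
  have DW x l : has_deriv V x l -> has_deriv W x
     (k%:R * (2 * x * h_ x + x ^+ 2 * h1 x) - l
      + A / (2 * k%:R) * (2 * V x * l)).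
    move=> hl; apply: has_deriv_eq.
      apply: has_derivD.
        apply: has_derivB hl.
        apply: has_derivM (has_deriv_cst x k%:R) _.
        exact: has_derivM (has_derivX 2 (has_deriv_id x)) (d1 x).
      exact: has_derivM (has_deriv_cst x (A / (2 * k%:R))) (has_derivX 2 hl).
    by rewrite /= !mul0r !add0r mulr1 expr1.
  have W0 : W 0 = 0 by rewrite /W V0 expr0n /= mul0r !mulr0 subrr addr0.
  move=> r0; have : W r = W 0.
    apply: derive0_eq0 => //.
      by have [l hl] := Vl 0; exact: has_deriv_continuous (DW _ _ hl).
    move=> x x0; apply: (has_deriv_eq (DW _ _ (dV x x0))).
    have e : x * h1 x = 2 * h_ x * (- (A / k%:R) * V x).
      by rewrite -first_int //; field; exact: hn.
    transitivity (k%:R * x * (x * h1 x - 2 * h_ x * (- (A / k%:R) * V x))).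
      by field; rewrite kn.
    by rewrite e subrr mulr0.
  by rewrite W0 /W => e; apply/eqP; rewrite -subr_eq0 -e; apply/eqP; ring.
have Vpos r : 0 < r -> 0 < V r.
  move=> r0; rewrite -V0.
  apply: (@has_deriv_lt V (fun r => 2 * k%:R * r * h_ r)) => //.
    by move=> x /andP[x0 _]; exact: dV.
  by move=> x /andP[x0 _]; rewrite !mulr_gt0.
pose Vinf := complex.Re
  (G (hpt (delta_mx 0 i0) 1 0) (lshift 2 i1) (lshift 2 i1)) - a_ 0.
have near_pos : \forall r \near +oo, (0 : R) < r by exact: nbhs_pinfty_gt.
have cV : V r @[r --> +oo] --> Vinf.
  apply: cvgB; last exact: cvg_cst.
  have := cvg_inv_pinfty (@infinity_continuous R n k i0 G hG (lshift 2 i1)).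
  apply: cvg_trans; apply: near_eq_cvg; apply: filterS near_pos => r r0.
  by have [-> _] := infinity_coeff r0.
have ch : k%:R * (r ^+ 2 * h_ r) @[r --> +oo] --> (0 : R).
  rewrite -(mulr0 k%:R); apply: cvgMl_tmp.
  have F0 := @infinity_continuous R n k i0 G hG (rshift n 1).
  have F1 :
      t ^+ 2 * complex.Re (G (hpt (delta_mx 0 i0) 1 t%:C) (rshift n 1) (rshift n 1))
      @[t --> (0 : R)] -->
      0 ^+ 2 * complex.Re (G (hpt (delta_mx 0 i0) 1 0) (rshift n 1) (rshift n 1)).
    apply: cvgM F0.
    exact: has_deriv_continuous (has_derivX 2 (has_deriv_id 0)).
  have := cvg_inv_pinfty F1; rewrite expr0n mul0r.
  apply: cvg_trans; apply: near_eq_cvg; apply: filterS near_pos => r r0.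
  by have [_ ->] := infinity_coeff r0.
have inf_eq : Vinf - A / (2 * k%:R) * Vinf ^+ 2 = 0.
  have cW : V r - A / (2 * k%:R) * V r ^+ 2 @[r --> +oo] -->
      Vinf - A / (2 * k%:R) * Vinf ^+ 2.
    by apply: cvgB => //; apply: cvgMl_tmp; exact: cvgM.
  apply: (cvg_unique _ cW); first exact: norm_hausdorff.
  apply: cvg_trans ch; apply: near_eq_cvg; apply: filterS near_pos => r r0.
  by rewrite second_int.
have Vinf0 : 0 < Vinf.
  apply: lt_le_trans (Vpos 1 ltr01) _; apply: (cvgr_to_ge cV).
  near=> r; have r1 : 1 < r by near: r; exact: nbhs_pinfty_gt.
  apply/ltW/(@has_deriv_lt V (fun r => 2 * k%:R * r * h_ r)) => //.
    by move=> x /andP[x1 _]; apply: dV; exact: lt_trans x1.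
  by move=> x /andP[x1 _]; rewrite !mulr_gt0 // (lt_trans _ x1).
have AV : A * Vinf = 2 * k%:R.
  have Vn : Vinf != 0 by rewrite gt_eqF.
  have -> : A * Vinf =
      2 * k%:R * (Vinf - (Vinf - A / (2 * k%:R) * Vinf ^+ 2)) / Vinf.
    by field; rewrite Vn kn.
  by rewrite inf_eq subr0; field.
have A0 : 0 < A by rewrite -(pmulr_lgt0 _ Vinf0) AV mulr_gt0.
have An : A != 0 by rewrite gt_eqF.
(* Positivity of h keeps V strictly below the second root 2k/A; this gives U < U_max. *)
have Vlt r : 0 < r -> A * V r < 2 * k%:R.
  move=> r0; have : 0 < V r * (2 * k%:R - A * V r).
    have -> : V r * (2 * k%:R - A * V r) =
        2 * k%:R * (V r - A / (2 * k%:R) * V r ^+ 2).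
      by field; rewrite kn.
    by rewrite -second_int // !mulr_gt0 // exprn_gt0.
  by rewrite pmulr_rgt0 ?Vpos // subr_gt0.
have n0 : 0 < n%:R :> R by rewrite ltr0n; case: (n) i0 => // -[].
have nn : (n%:R : R) != 0 by rewrite gt_eqF.
have a0 := base_coeff_gt0 0.
have an : a_ 0 != 0 by rewrite gt_eqF.
(* On E_0, where U = 0, the coefficient 1 + (k/n) U = c a / n has to be 1, which gives c and U =
   (c/k) V. Then s is read off from n s = U_max = (c/k) (2k/A). *)
pose c := n%:R / a_ 0; pose s := 2 * c / (n%:R * A).
have c0 : 0 < c by rewrite divr_gt0.
have cn : c != 0 by rewrite gt_eqF.
have s0 : 0 < s by rewrite divr_gt0 // mulr_gt0.
exists c, s; split => //; split; first exact: unitary_kahler_metricZ.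
have ns : n%:R * s = 2 * c / A by rewrite /s; field; rewrite nn An.
have phiE r : 0 < r -> hitchin_phi n s (c / k%:R * V r) = 2 * c * (r ^+ 2 * h_ r).
  move=> r0; rewrite hitchin_phiE ns; last first.
    by rewrite mulf_neq0 ?invr_eq0 // mulf_neq0 // pnatr_eq0.
  have -> : r ^+ 2 * h_ r = (V r - A / (2 * k%:R) * V r ^+ 2) / k%:R.
    by rewrite -second_int //; field.
  by field; rewrite An cn kn.
have dU r : 0 < r -> has_deriv (fun r => c / k%:R * V r) r
    (hitchin_phi n s (c / k%:R * V r) / r).
  move=> r0; apply: has_deriv_eq.
    exact: has_derivM (has_deriv_cst r (c / k%:R)) (dV r r0).
  by rewrite phiE //; field; rewrite kn gt_eqF.
exists (fun r => c / k%:R * V r); split.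
- move=> r r0; have [du _] := dU r r0; split => //; last first.
    by rewrite (has_deriv_derive1 (dU r r0)) mulrC divfK // gt_eqF.
  apply/andP; split; first by rewrite mulr_gt0 ?Vpos // divr_gt0.
  rewrite ns -subr_gt0.
  have -> : 2 * c / A - c / k%:R * V r = c / (A * k%:R) * (2 * k%:R - A * V r).
    by field; rewrite An kn.
  by rewrite mulr_gt0 ?divr_gt0 ?mulr_gt0 // subr_gt0 Vlt.
- have := @cvgMl_tmp _ _ _ _ _ (c / k%:R) _ (cvg_at_right_filter Vc).
  by rewrite mulr0 => h; exact: h.
- rewrite ns; have -> : 2 * c / A = c / k%:R * Vinf.
    have -> : Vinf = 2 * k%:R / A by rewrite -AV mulrC mulKf.
    by field; rewrite An kn.
  exact: cvgMl_tmp.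
move=> p X hp; have r0 := rad_gt0 k hp; set r := rad k p in r0 *.
have ph : 0 < hitchin_phi n s (c / k%:R * V r).
  rewrite phiE //; apply: mulr_gt0; first by rewrite mulr_gt0.
  by apply: mulr_gt0 => //; exact: exprn_gt0.
have := @dt_form_sqr R n k (hitchin_phi n s) (fun r => c / k%:R * V r) p X
  hp ph (dU r r0).
rewrite -addrA -/r => ->; rewrite phiE //.
have -> : 1 + k%:R / n%:R * (c / k%:R * V r) = c * a_ r / n%:R.
  by rewrite /V /c; field; rewrite nn an kn.
rewrite sform_scale (metric_structure k_gt0 i10 hG) // -/r [in RHS]rmorphD.
rewrite (rmorphM (real_complex R) (c * a_ r / n%:R)) /= fubini_study_fs; last by case: hp.
rewrite -sqnormE.
have -> : (c * a_ r / n%:R)%:C = c%:C * (a_ r)%:C / n%:R :> R[i].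
  by rewrite (rmorphM (real_complex R) (c * a_ r)) (rmorphM (real_complex R) c)
    fmorphV rmorph_nat.
have -> : (2 * c * (r ^+ 2 * h_ r) * sqnorm (log_form k p X))%:C =
   2 * c%:C * ((r ^+ 2 * h_ r)%:C * (sqnorm (log_form k p X))%:C).
  rewrite (rmorphM (real_complex R) (2 * c * _)) (rmorphM (real_complex R) (2 * c)).
  by rewrite (rmorphM (real_complex R) 2) rmorph_nat !mulrA.
move: (_ ^+ 2 * _)%:C (a_ r)%:C (sqnorm _)%:C (fs_form _ _ _) => x y z w.
by field; rewrite pnatr_eq0 -lt0n -(ltr0n R).
Unshelve. all: by end_near. Qed.

End ConstantCurvatureODE.

Theorem proposition1p4 (R : realType) (n k : nat)
    (hn : (2 <= n)%N) (hk : (1 <= k)%N)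
    (G : 'rV[R[i]]_(n + 2) -> 'M[R[i]]_(n + 2))
    (hG : unitary_kahler_metric k G) :
  constant_A G <->
  exists c s : R,
    [/\ 0 < c, 0 < s & hitchin_metric k s (fun p => c%:C *: G p)].
Proof.
have n0 : (0 < n)%N by exact: ltn_trans hn.
(* The second axis, available since n >= 2, gives a direction tangent to the base at [e_{i0}]. *)
pose i0 := Ordinal n0; pose i1 := Ordinal hn.
have i10 : i1 != i0 by [].
split=> [[A hA]|[c [s [c0 s0 [_ hgen]]]]].
  by apply: (constant_A_hitchin hk i10 hG (A := A)) => p e0; exact: hA.
exact (hitchin_constant_A hk i10 hG c0 s0 hgen).
Qed.
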